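(* Let $k$ be an algebraically closed field and let $\Lambda$ be a finite-dimensional $k$-algebra which is controlled wild. Let $V$ be any projective variety over $k$. Then there are finite-dimensional $\Lambda$-modules $D, Y$ and a dimension vector $\mathbf{e}$ for the algebra $\Gamma(D) = \operatorname{End}_\Lambda(D)^{\mathrm{op}}$ such that the quiver Grassmannian $\mathbb{G}_{\mathbf{e}}(\operatorname{Hom}_\Lambda(D,Y))$ of the $\Gamma(D)$-module $\operatorname{Hom}_\Lambda(D,Y)$ is isomorphic to $V$ as a variety.
   Context: Throughout, $k$ is an algebraically closed field, and modules over a finite-dimensional $k$-algebra are finite-dimensional left modules; $\operatorname{mod}\Lambda$ is the category of such $\Lambda$-modules. A projective variety over $k$ is a closed subset of some projective space $\mathbb{P}^n$ over $k$ (not required to be irreducible). Dimension vectors: a dimension vector for a finite-dimensional $k$-algebra $\Lambda$ is a function $\mathbf{d}$ from the set of isomorphism classes of simple $\Lambda$-modules to the non-negative integers. The dimension vector $\mathbf{dim}\, M$ of a $\Lambda$-module $M$ assigns to a simple module $S$ the Jordan–Hölder multiplicity $[M:S]$ of $S$ in $M$. Quiver Grassmannians: for a $\Lambda$-module $M$ and a dimension vector $\mathbf{e}$, $\mathbb{G}_{\mathbf{e}}(M)$ is the set of all submodules of $M$ with dimension vector $\mathbf{e}$. It is a projective variety, as a closed subset of the usual Grassmannian of subspaces of $M$ of dimension $\sum_S e_S\dim_k S$. For $\Lambda$-modules $D,Y$, the space $\operatorname{Hom}_\Lambda(D,Y)$ is regarded as a left module over $\Gamma(D)=\operatorname{End}_\Lambda(D)^{\mathrm{op}}$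 via precomposition. The quiver Grassmannians $\mathbb{G}_{\mathbf{e}}(\operatorname{Hom}_\Lambda(D,Y))$ are called the Auslander varieties for $\Lambda$. Controlled wild: let $\operatorname{rad}$ be the radical of $\operatorname{mod}\Lambda$, i.e. the ideal of the category $\operatorname{mod}\Lambda$ generated by all non-invertible maps between indecomposable modules. For a collection $\mathcal{C}$ of objects of $\operatorname{mod}\Lambda$, let $\operatorname{add}\mathcal{C}$ be its closure under (finite) direct sums and direct summands, and let $\operatorname{Hom}(X,\mathcal{C},Y)\subseteq \operatorname{Hom}(X,Y)$ be the subgroup of all maps $X\to Y$ which factor through a module in $\operatorname{add}\mathcal{C}$. The algebra $\Lambda$ is called controlled wild if for any finite-dimensional $k$-algebra $\Gamma$ there is an exact embedding functor (a $k$-linear, exact, faithful functor) $F:\operatorname{mod}\Gamma\to\operatorname{mod}\Lambda$ and a full subcategory $\mathcal{C}$ of $\operatorname{mod}\Lambda$ such that for all $\Gamma$-modules $X,Y$, the subgroup $\operatorname{Hom}(FX,\mathcal{C},FY)$ is contained in $\operatorname{rad}(FX,FY)$ and $$\operatorname{Hom}(FX,FY)=F\operatorname{Hom}(X,Y)\oplus\operatorname{Hom}(FX,\mathcal{C},FY).$$ *)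

(* Defs.v *)
From HB Require Import structures.
From mathcomp Require Import all_boot all_order all_algebra.
From mathcomp Require Import mpoly.

Set Implicit Arguments.
Unset Strict Implicit.
Unset Printing Implicit Defensive.

Import GRing.Theory.
Local Open Scope ring_scope.

(** * Finite-dimensional algebras and modules *)

(* The library's [algType] and [falgType] require [1 != 0]. The zero algebra has
   to be allowed here, as it is the endomorphism algebra of the zero module. *)
Record fdalg (k : fieldType) := FdAlg {
  alg_car :> vectType k;
  alg_one : alg_car;
  alg_mul : alg_car -> alg_car -> alg_car;
  alg_mulA : associative alg_mul;
  alg_mul1l : left_id alg_one alg_mul;
  alg_mul1r : right_id alg_one alg_mul;
  alg_mul_linl : forall b, linear (alg_mul^~ b);
  alg_mul_linr : forall a, linear (alg_mul a) }.

Record fdmod (k : fieldType) (A : fdalg k) := FdMod {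
  mod_car :> vectType k;
  mod_act : {linear A -> 'End(mod_car)};
  mod_act1 : mod_act (alg_one A) = \1%VF;
  mod_actM : forall a b : A,
    mod_act (alg_mul a b) = (mod_act a \o mod_act b)%VF }.

Section Homs.
Variables (k : fieldType) (A : fdalg k).
Implicit Types (M N P Q : fdmod A).

(* The space of [A]-linear maps, cut out by the commutation conditions for the
   elements of a basis of [A]; [homsP] is the usual description. *)
Definition act_defect M N (a : A) (f : 'Hom(M, N)) : 'Hom(M, N) :=
  (f \o mod_act M a)%VF - (mod_act N a \o f)%VF.

Definition homs M N : {vspace 'Hom(M, N)} :=
  (\bigcap_(i < \dim {:A})
     lker (linfun (@act_defect M N (vbasis {:A})`_i)))%VS.

Lemma act_defect_is_linear M N a : linear (@act_defect M N a).
Proof.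
move=> c f g; rewrite /act_defect comp_lfunDl -comp_lfunZl.
by rewrite comp_lfunDr -comp_lfunZr scalerBr opprD addrACA.
Qed.
HB.instance Definition _ M N a :=
  GRing.isLinear.Build k 'Hom(M, N) 'Hom(M, N) _ (@act_defect M N a)
    (@act_defect_is_linear M N a).

Lemma homsP M N (f : 'Hom(M, N)) :
  f \in homs M N <-> forall a v, f (mod_act M a v) = mod_act N a (f v).
Proof.
split=> [fP a v | fP].
  have {}fP i : @act_defect M N (vbasis {:A})`_i f = 0.
    have [lti|gei] := ltnP i (\dim {:A}); last first.
      rewrite nth_default ?size_tuple // /act_defect !linear0.
      by rewrite comp_lfun0r comp_lfun0l subrr.
    move: fP; rewrite memvE => /subv_bigcapP.
    by move=> /(_ (Ordinal lti) isT); rewrite -memvE memv_ker lfunE => /eqP.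
  rewrite (coord_vbasis (memvf a)) !linear_sum /= !sum_lfunE linear_sum /=.
  apply: eq_bigr => i _; rewrite !linearZ /= !scale_lfunE linearZ /=; congr (_ *: _).
  apply/eqP; rewrite -subr_eq0; move/lfunP/(_ v): (fP i).
  by rewrite add_lfunE opp_lfunE !comp_lfunE zero_lfunE => ->.
rewrite memvE; apply/subv_bigcapP => i _; rewrite -memvE memv_ker lfunE /=.
apply/eqP/lfunP => v.
by rewrite add_lfunE opp_lfunE !comp_lfunE zero_lfunE fP subrr.
Qed.

Definition hom M N := subvs_of (homs M N).

Lemma hom_actE M N (f : hom M N) a v :
  vsval f (mod_act M a v) = mod_act N a (vsval f v).
Proof. by case: (homsP (vsval f)) => H _; apply: H; apply: subvsP. Qed.

Lemma hom_id_subproof M : \1%VF \in homs M M.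
Proof. by apply/homsP => a v; rewrite !id_lfunE. Qed.
Definition hom_id M : hom M M := Subvs (hom_id_subproof M).

Lemma hom_comp_subproof M N P (g : hom N P) (f : hom M N) :
  (vsval g \o vsval f)%VF \in homs M P.
Proof. by apply/homsP => a v; rewrite !comp_lfunE !hom_actE. Qed.
Definition hom_comp M N P (g : hom N P) (f : hom M N) : hom M P :=
  Subvs (hom_comp_subproof g f).

Lemma hom_compA M N P Q (h : hom P Q) (g : hom N P) (f : hom M N) :
  hom_comp h (hom_comp g f) = hom_comp (hom_comp h g) f.
Proof. by apply: val_inj; rewrite /= comp_lfunA. Qed.

Lemma hom_comp1l M N (f : hom M N) : hom_comp (hom_id N) f = f.
Proof. by apply: val_inj; rewrite /= comp_lfun1l. Qed.

Lemma hom_comp1r M N (f : hom M N) : hom_comp f (hom_id M) = f.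
Proof. by apply: val_inj; rewrite /= comp_lfun1r. Qed.

Lemma hom_comp_linl M N P (f : hom M N) :
  linear (fun g : hom N P => hom_comp g f).
Proof.
by move=> c g h; apply: val_inj; rewrite /= comp_lfunDl comp_lfunZl.
Qed.

Lemma hom_comp_linr M N P (g : hom N P) :
  linear (fun f : hom M N => hom_comp g f).
Proof.
by move=> c f h; apply: val_inj; rewrite /= comp_lfunDr comp_lfunZr.
Qed.

(** * The category of finite-dimensional modules *)

Definition invertible M N (f : hom M N) : Prop :=
  exists g : hom N M, hom_comp g f = hom_id M /\ hom_comp f g = hom_id N.

Definition isomorphic M N : Prop := exists f : hom M N, invertible f.

Definition zero_mod M : Prop := \dim {:M} = 0%N.

Definition short_exact M N P (f : hom M N) (g : hom N P) : Prop :=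
  [/\ lker (vsval f) = 0%VS, limg (vsval f) = lker (vsval g)
    & limg (vsval g) = fullv].

Definition is_biproduct P M N : Prop :=
  exists (i1 : hom M P) (i2 : hom N P) (p1 : hom P M) (p2 : hom P N),
    [/\ hom_comp p1 i1 = hom_id M, hom_comp p2 i2 = hom_id N,
        hom_comp p1 i2 = 0, hom_comp p2 i1 = 0
      & hom_comp i1 p1 + hom_comp i2 p2 = hom_id P].

Definition indecomposable M : Prop :=
  ~ zero_mod M /\
  forall N P, is_biproduct M N P -> zero_mod N \/ zero_mod P.

Inductive radical : forall M N, hom M N -> Prop :=
| radical_gen M N (f : hom M N) :
    indecomposable M -> indecomposable N -> ~ invertible f -> radical f
| radical_0 M N : radical (0 : hom M N)
| radical_add M N (f g : hom M N) : radical f -> radical g -> radical (f + g)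
| radical_compl M N P (g : hom N P) (f : hom M N) :
    radical f -> radical (hom_comp g f)
| radical_compr M N P (g : hom N P) (f : hom M N) :
    radical g -> radical (hom_comp g f).

Inductive add_closure (C : fdmod A -> Prop) : fdmod A -> Prop :=
| add_closure_in M : C M -> add_closure C M
| add_closure_0 M : zero_mod M -> add_closure C M
| add_closure_sum P M N :
    is_biproduct P M N -> add_closure C M -> add_closure C N -> add_closure C P
| add_closure_summand P M N :
    is_biproduct P M N -> add_closure C P -> add_closure C M.

Definition factors_through (C : fdmod A -> Prop) M N (h : hom M N) : Prop :=
  exists (P : fdmod A) (g : hom P N) (f : hom M P),
    add_closure C P /\ h = hom_comp g f.

(** * Submodules, composition multiplicities and dimension vectors *)

Definition submodule M (U : {vspace M}) : Prop :=
  forall (a : A) (u : M), u \in U -> mod_act M a u \in U.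

Definition simple_mod M : Prop :=
  ~ zero_mod M /\
  forall U : {vspace M}, submodule U -> U = 0%VS \/ U = fullv.

Record simple := Simple { simple_car :> fdmod A; simpleP : simple_mod simple_car }.

Definition submod_act M (U : {vspace M}) (a : A) : 'End(subvs_of U) :=
  linfun (vsproj U \o mod_act M a \o vsval).

Lemma submod_actE M (U : {vspace M}) (sU : submodule U) a (u : subvs_of U) :
  vsval (submod_act U a u) = mod_act M a (vsval u).
Proof. by rewrite lfunE /= vsprojK // sU ?subvsP. Qed.

Lemma submod_act_is_linear M (U : {vspace M}) : linear (@submod_act M U).
Proof.
move=> c a b; apply/lfunP => u.
rewrite add_lfunE scale_lfunE !lfunE /= linearP /= add_lfunE scale_lfunE.
by rewrite linearP.
Qed.
HB.instance Definition _ M (U : {vspace M}) :=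
  GRing.isLinear.Build k A 'End(subvs_of U) _ (@submod_act M U)
    (@submod_act_is_linear M U).

Lemma submod_act1 M (U : {vspace M}) (sU : submodule U) :
  submod_act U (alg_one A) = \1%VF.
Proof.
apply/lfunP => u; apply: val_inj; rewrite /= submod_actE //.
by rewrite mod_act1 !id_lfunE.
Qed.

Lemma submod_actM M (U : {vspace M}) (sU : submodule U) a b :
  submod_act U (alg_mul a b) = (submod_act U a \o submod_act U b)%VF.
Proof.
apply/lfunP => u; apply: val_inj; rewrite /= comp_lfunE !submod_actE //.
by rewrite mod_actM comp_lfunE.
Qed.

Definition submod M (U : {vspace M}) (sU : submodule U) : fdmod A :=
  @FdMod k A (subvs_of U) (@submod_act M U) (submod_act1 sU) (submod_actM sU).

(* [jh_mult S M n]: the module [M] has a composition series, built up from [0]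
   by successive extensions by simple modules [T], in which exactly [n] of the
   factors [T] are isomorphic to [S]. *)
Inductive jh_mult (S : simple) : fdmod A -> nat -> Prop :=
| jh_mult_0 M : zero_mod M -> jh_mult S M 0
| jh_mult_iso M' M (T : simple) (f : hom M' M) (g : hom M T) n :
    short_exact f g -> isomorphic T S -> jh_mult S M' n -> jh_mult S M n.+1
| jh_mult_noniso M' M (T : simple) (f : hom M' M) (g : hom M T) n :
    short_exact f g -> ~ isomorphic T S -> jh_mult S M' n -> jh_mult S M n.

Record dimvec := DimVec {
  dimvec_fun :> simple -> nat;
  dimvec_iso : forall S T : simple,
    isomorphic S T -> dimvec_fun S = dimvec_fun T }.

Definition has_dimvec M (e : dimvec) : Prop :=
  forall S : simple, jh_mult S M (e S).

(* [d] is the sum of [e S * dim S] over the isomorphism classes of simple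
   modules; [ss] is a system of representatives of these classes. *)
Definition total_dim (e : dimvec) (d : nat) : Prop :=
  exists (r : nat) (ss : 'I_r -> simple),
    (forall S : simple, exists! i, isomorphic S (ss i)) /\
    d = (\sum_(i < r) e (ss i) * \dim {:ss i})%N.

End Homs.

(** * Controlled wild algebras *)

Record functor (k : fieldType) (A B : fdalg k) := Functor {
  fun_obj :> fdmod A -> fdmod B;
  fun_mor : forall X Y : fdmod A, {linear hom X Y -> hom (fun_obj X) (fun_obj Y)};
  fun_id : forall X, fun_mor X X (hom_id X) = hom_id (fun_obj X);
  fun_comp : forall X Y Z (g : hom Y Z) (f : hom X Y),
    fun_mor X Z (hom_comp g f) = hom_comp (fun_mor Y Z g) (fun_mor X Y f) }.

Definition exact_functor (k : fieldType) (A B : fdalg k) (F : functor A B) :=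
  forall (X Y Z : fdmod A) (f : hom X Y) (g : hom Y Z),
    short_exact f g -> short_exact (fun_mor F X Y f) (fun_mor F Y Z g).

Definition faithful_functor (k : fieldType) (A B : fdalg k) (F : functor A B) :=
  forall X Y : fdmod A, injective (fun_mor F X Y).

Definition controlled_wild (k : fieldType) (L : fdalg k) : Prop :=
  forall G : fdalg k, exists (F : functor G L) (C : fdmod L -> Prop),
    [/\ exact_functor F, faithful_functor F &
      forall X Y : fdmod G,
      [/\ forall h : hom (F X) (F Y), factors_through C h -> radical h,
          forall h : hom (F X) (F Y), exists (f : hom X Y) (c : hom (F X) (F Y)),
            factors_through C c /\ h = fun_mor F X Y f + c
        & forall f : hom X Y, factors_through C (fun_mor F X Y f) ->
            fun_mor F X Y f = 0]].

(** * The algebra [End(D)^op] and the module [Hom(D, Y)] *)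

Section Auslander.
Variables (k : fieldType) (A : fdalg k).
Implicit Types D Y : fdmod A.

Definition endop_mul D (f g : hom D D) : hom D D := hom_comp g f.

Definition endop D : fdalg k :=
  @FdAlg k (hom D D) (hom_id D) (@endop_mul D)
    (fun f g h => esym (hom_compA h g f))
    (fun f => hom_comp1r f) (fun f => hom_comp1l f)
    (fun g => @hom_comp_linr _ _ D D D g) (fun f => @hom_comp_linl _ _ D D D f).

Definition hom_mod_act D Y (c : endop D) : 'End(hom D Y) :=
  linfun (fun h : hom D Y => hom_comp h c).

Lemma hom_mod_actE D Y (c : endop D) (h : hom D Y) :
  hom_mod_act Y c h = hom_comp h c.
Proof.
pose l := GRing.isLinear.Build _ _ _ _ _ (@hom_comp_linl _ _ D D Y c).
pose f : {linear hom D Y -> hom D Y} :=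
  HB.pack (fun h : hom D Y => hom_comp h c) l.
exact: (lfunE f h).
Qed.

Lemma hom_mod_act_is_linear D Y : linear (@hom_mod_act D Y).
Proof.
move=> x c c'; apply/lfunP => h.
by rewrite add_lfunE scale_lfunE !hom_mod_actE hom_comp_linr.
Qed.
HB.instance Definition _ D Y :=
  GRing.isLinear.Build k (endop D) 'End(hom D Y) _ (@hom_mod_act D Y)
    (@hom_mod_act_is_linear D Y).

Lemma hom_mod_act1 D Y : hom_mod_act Y (alg_one (endop D)) = \1%VF.
Proof. by apply/lfunP => h; rewrite hom_mod_actE id_lfunE hom_comp1r. Qed.

Lemma hom_mod_actM D Y (c c' : endop D) :
  hom_mod_act Y (alg_mul c c') = (hom_mod_act Y c \o hom_mod_act Y c')%VF.
Proof.
by apply/lfunP => h; rewrite comp_lfunE !hom_mod_actE; apply: hom_compA.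
Qed.

Definition hom_mod D Y : fdmod (endop D) :=
  @FdMod k (endop D) (hom D Y) (@hom_mod_act D Y)
    (hom_mod_act1 D Y) (@hom_mod_actM D Y).

End Auslander.

(** * Projective varieties *)

(* A point of the projective space with [n] homogeneous coordinates (so of
   dimension [n - 1]) is a line [L] in [k^n], i.e. [\dim L = 1]; the line with
   homogeneous coordinates [x != 0] is [<[x]>]. *)
Section Projective.
Variable k : fieldType.

Definition proj_set (n : nat) := {vspace 'rV[k]_n} -> Prop.

Definition zariski_closed n (V : proj_set n) : Prop :=
  exists F : {mpoly k[n]} -> Prop,
    (forall f, F f -> exists d : nat, f \is d.-homog) /\
    forall L, V L <->
      \dim L = 1%N /\ forall f, F f -> forall x, x \in L -> f.@[x 0] = 0.

(* Near each point, [phi] is given by homogeneous polynomials of the same degree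
   without common zero; the neighbourhoods are basic open sets [g != 0]. *)
Definition regular_map n m (V : proj_set n) (W : proj_set m)
    (phi : {vspace 'rV[k]_n} -> {vspace 'rV[k]_m}) : Prop :=
  (forall L, V L -> W (phi L)) /\
  forall x : 'rV[k]_n, x != 0 -> V <[x]>%VS ->
  exists (d e : nat) (g : {mpoly k[n]}) (f : 'I_m -> {mpoly k[n]}),
    [/\ g \is d.-homog, forall i, f i \is e.-homog, g.@[x 0] != 0 &
      forall y : 'rV[k]_n, y != 0 -> V <[y]>%VS -> g.@[y 0] != 0 ->
        let fy := \row_i (f i).@[y 0] in
        fy != 0 /\ phi <[y]>%VS = <[fy]>%VS].

Definition variety_iso n m (V : proj_set n) (W : proj_set m) : Prop :=
  exists (phi : {vspace 'rV[k]_n} -> {vspace 'rV[k]_m})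
         (psi : {vspace 'rV[k]_m} -> {vspace 'rV[k]_n}),
    [/\ regular_map V W phi, regular_map W V psi,
        forall L, V L -> psi (phi L) = L
      & forall L, W L -> phi (psi L) = L].

End Projective.

(** * Quiver Grassmannians *)

Section QuiverGrassmannian.
Variables (k : fieldType) (E : vectType k).

Definition plucker_index (d : nat) :=
  [set J : {ffun 'I_d -> 'I_(\dim {:E})} |
    [forall i : 'I_d, forall j : 'I_d, (i < j)%N ==> (J i < J j)%N]].

(* The Plucker embedding of the Grassmannian of [d]-dimensional subspaces of [E],
   with respect to the coordinates of [E] given by [vbasis {:E}]: the maximal
   minors of the matrix whose rows are the coordinates of a basis of [U]. *)
Definition plucker d (U : {vspace E}) : {vspace 'rV[k]_#|plucker_index d|} :=
  let B := \matrix_(i < d, j < \dim {:E})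
             coord (vbasis {:E}) j (vbasis U)`_i in
  <[\row_t \det (colsub (enum_val t : {ffun _ -> _}) B)]>%VS.

End QuiverGrassmannian.

(* The submodules of [M] with dimension vector [e], where [d] is the total
   dimension of [e], as a subset of projective space. *)
Definition quiver_grassmannian (k : fieldType) (A : fdalg k) (M : fdmod A)
    (e : dimvec A) (d : nat) : proj_set k #|plucker_index M d| :=
  fun L => exists (U : {vspace M}) (sU : submodule U),
    [/\ has_dimvec (submod sU) e, \dim U = d & L = plucker d U].

Arguments quiver_grassmannian [k A] M e d _.

(* Main.v *)
Require Import Defs.
From HB Require Import structures.
From mathcomp Require Import all_boot all_order all_algebra.
From mathcomp Require Import fingroup perm mpoly zify ring.
From Stdlib Require Import Classical ClassicalEpsilon.
Import Defs.

(** A functor [F] witnessing that [L] is controlled wild, applied to the regular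
    module and to a module [M] of an auxiliary algebra [G], almost realizes [M] as
    [Hom(F(G), F(M))]: the error consists of the maps factoring through [C]. Put
    [D = F(G) + C'] and [Y = F(M)], where [C'] is an object of [add C] through which
    all these maps factor. Then [Hom(D, Y)] maps onto [M] along a surjection from
    [End(D)^op] to [G], and every submodule of [Hom(D, Y)] containing [Hom(C', Y)]
    contains the kernel. A dimension vector that is maximal on the idempotent of [C']
    forces this inclusion (by Jordan-Hoelder), so that the quiver Grassmannian becomes
    one of [M].

    For [G] take the algebra of a generalized Kronecker quiver and for [M] the
    representation by which the monomials of degree [d - 1] contract tensors of degree
    [d] to vectors, restricted to the tensors satisfying the equations of [V] in degree
    [d]. A subrepresentation of dimension vector [(1, 1)] is then spanned by a point of
    [V] and its Veronese image. *)

Set Implicit Arguments.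
Unset Strict Implicit.
Unset Printing Implicit Defensive.

Import GRing.Theory.
Local Open Scope ring_scope.

(** The obstacle is that little is known about Hom(FX, C, FY) beyond its being a complement of F
    Hom(X, Y), so Hom(D, Y) cannot be computed. Adding C' to D makes the unknown part manageable:
    the kernel of Hom(D, Y) -> M is generated by the image of the idempotent eps belonging to C',
    and eps maps everything into that kernel. The rank of an idempotent on a submodule is additive
    in exact sequences, hence a function of the dimension vector. So the dimension vector alone can
    prescribe that eps U is all of eps Hom(D, Y), whatever the kernel looks like, and the ranks of
    two lifted diagonal idempotents then leave one line at each vertex of M.

    Tensors are used because they make equations linear: an equation of degree e times a monomial of
    degree d - e is a linear condition on tensors of degree d. This asks for one d that serves all
    equations, whereas a closed set may be given by infinitely many of them; hence the basis
    theorem.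

    The isomorphism with V is proved in Pluecker coordinates: the graph of a point has minors
    polynomial in the point, and suitable linear forms in these minors give back the point. *)

(** * Linear algebra and modules *)

Section LinearAlgebra.
Variable k : fieldType.

(** Starting from 0, a vector of [P] outside the current subspace is adjoined as long as there is
    one; the dimension of [E] bounds the number of rounds. *)
Lemma vspace_of_pred (E : vectType k) (P : E -> Prop) :
  P 0 -> (forall c u v, P u -> P v -> P (c *: u + v)) ->
  exists U : {vspace E}, forall v, v \in U <-> P v.
Proof.
move=> P0 Plin.
suff H : forall m (U : {vspace E}), (forall v, v \in U -> P v) ->
    (\dim {:E} - \dim U < m)%N ->
    exists U : {vspace E}, forall v, v \in U <-> P v.
  by apply: (H _ 0%VS (fun v => _) (ltnSn _)) => v; rewrite memv0 => /eqP ->.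
elim=> [U _|m IH U UP dU]; first by rewrite ltn0.
case: (classic (forall v, P v -> v \in U)) => [PU | /not_all_ex_not [v]].
  by exists U => v; split; [apply: UP | apply: PU].
move=> nPU; have [Pv /negP vU] := imply_to_and _ _ nPU; apply: (IH (<[v]> + U)%VS).
  move=> _ /memv_addP [_ /vlineP [c ->] [w wU ->]].
  by apply: Plin => //; apply: UP.
have lt : (\dim U < \dim (<[v]> + U))%N.
  rewrite (ltn_leqif (dimv_leqif_sup (addvSr _ _))); apply/negP => /subvP H.
  by move: vU; rewrite H // (subvP (addvSl _ _)) // memv_line.
have := dimvS (subvf (<[v]> + U)); lia.
Qed.

Lemma linfun_apply (U V : vectType k) (f : U -> V) : linear f -> linfun f =1 f.
Proof.
move=> fl; pose l := GRing.isLinear.Build _ _ _ _ _ fl.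
pose f' : {linear U -> V} := HB.pack f l.
exact: (lfunE f').
Qed.

Lemma linear_combination (U V : lmodType k) (f : U -> V) (I : Type) (s : seq I)
    (P : pred I) (c : I -> k) (v : I -> U) : linear f ->
  f (\sum_(i <- s | P i) c i *: v i) = \sum_(i <- s | P i) c i *: f (v i).
Proof.
move=> fl; have f0 : f 0 = 0 by have := fl (-1) 0 0; rewrite scaler0 addr0 scaleN1r addNr.
by elim/big_rec2: _ => // i y u _ <-; rewrite fl.
Qed.

(** Since [R] is closed under linear combinations, two values at the same vector differ by a value
    at 0, so single-valuedness has to be checked at 0 only. Lifts and the map [q] below are obtained
    in this way, without choosing bases. *)
Lemma linfun_of_rel (E G : vectType k) (R : E -> G -> Prop) :
  (forall u, exists v, R u v) -> (forall v, R 0 v -> v = 0) ->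
  (forall c u v u' v', R u v -> R u' v' -> R (c *: u + u') (c *: v + v')) ->
  exists f : 'Hom(E, G), forall u v, R u v <-> v = f u.
Proof.
move=> Rtot R0 Rlin.
have Runiq u v v' : R u v -> R u v' -> v = v'.
  move=> Rv Rv'; have := Rlin (-1) _ _ _ _ Rv Rv'.
  by rewrite scaleN1r addNr => /R0 /eqP; rewrite scaleN1r addrC subr_eq0 => /eqP.
pose f u := proj1_sig (constructive_indefinite_description _ (Rtot u)).
have fP u : R u (f u) by apply: proj2_sig.
have flin : linear f by move=> c u v; apply: (Runiq (c *: u + v)) => //; apply: Rlin.
exists (linfun f) => u v; rewrite linfun_apply //; split=> [Rv | ->]; last exact: fP.
exact: Runiq (fP u).
Qed.

End LinearAlgebra.

Section Modules.
Variables (k : fieldType) (A : fdalg k).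
Implicit Types M N P Q : fdmod A.

Lemma zero_modP M : zero_mod M <-> forall v : M, v = 0.
Proof.
rewrite /zero_mod; split=> [/eqP | H].
  by rewrite dimv_eq0 => /eqP H v; apply/eqP; rewrite -memv0 -H memvf.
by apply/eqP; rewrite dimv_eq0 -subv0; apply/subvP => v _; rewrite (H v) mem0v.
Qed.

Lemma hom_ext M N (f g : hom M N) : (forall v, vsval f v = vsval g v) -> f = g.
Proof. by move=> fg; apply: val_inj; apply/lfunP. Qed.

Definition mk_hom M N (f : 'Hom(M, N))
    (fA : forall a v, f (mod_act M a v) = mod_act N a (f v)) : hom M N :=
  Subvs (proj2 (homsP f) fA).

Lemma act1E M (v : M) : mod_act M (alg_one A) v = v.
Proof. by rewrite mod_act1 id_lfunE. Qed.

Lemma actME M a b (v : M) :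
  mod_act M (alg_mul a b) v = mod_act M a (mod_act M b v).
Proof. by rewrite mod_actM comp_lfunE. Qed.

Lemma lfB (U V : vectType k) (f : 'Hom(U, V)) u v : f (u - v) = f u - f v.
Proof. exact: linearB. Qed.

Lemma lfD (U V : vectType k) (f : 'Hom(U, V)) u v : f (u + v) = f u + f v.
Proof. exact: linearD. Qed.

Lemma lfZ (U V : vectType k) (f : 'Hom(U, V)) (c : k) v : f (c *: v) = c *: f v.
Proof. exact: linearZ. Qed.

Lemma short_exactP M N P (f : hom M N) (g : hom N P) :
  short_exact f g <->
  [/\ injective (vsval f),
      forall v, vsval g v = 0 <-> exists u, v = vsval f u
    & forall w, exists v, vsval g v = w].
Proof.
split=> [[/eqP/lker0P finj fg gs] | [finj fg gs]].
  split=> // [v | w].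
    split=> [/eqP | [u ->]].
      by rewrite -memv_ker -fg => /memv_imgP [u _ ->]; exists u.
    by apply/eqP; rewrite -memv_ker -fg memv_img ?memvf.
  have : w \in limg (vsval g) by rewrite gs memvf.
  by case/memv_imgP => v _ ->; exists v.
split.
- by apply/eqP/lker0P.
- apply/vspaceP => v; rewrite memv_ker; apply/idP/eqP => [/memv_imgP [u _ ->] | /fg [u ->]].
    by apply/fg; exists u.
  by rewrite memv_img ?memvf.
- apply/vspaceP => w; rewrite memvf; have [v <-] := gs w.
  by rewrite memv_img ?memvf.
Qed.

Lemma submodule_ker M N (f : hom M N) : submodule (lker (vsval f)).
Proof. by move=> a u; rewrite !memv_ker hom_actE => /eqP ->; rewrite linear0. Qed.

Lemma submodule_img M N (f : hom M N) (U : {vspace M}) :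
  submodule U -> submodule (vsval f @: U)%VS.
Proof.
move=> sU a _ /memv_imgP [u uU ->]; rewrite -hom_actE memv_img //; exact: sU.
Qed.

Lemma submodule_full M : submodule {:M}%VS.
Proof. by move=> a u _; rewrite memvf. Qed.

Lemma lift_inj M N P (f : hom N M) (h : hom P M) :
  injective (vsval f) -> (forall v, exists u, vsval h v = vsval f u) ->
  exists g : hom P N, forall v, vsval f (vsval g v) = vsval h v.
Proof.
move=> finj hf.
have [|c u v u' v' hu hu'|g gP] := @linfun_of_rel _ P N (fun u v => vsval h u = vsval f v) hf.
- by move=> v; rewrite linear0 => /esym/eqP; rewrite -[0](linear0 (vsval f)) => /eqP/finj.
- by rewrite !linearP /= hu hu'.
have fg v : vsval f (g v) = vsval h v by apply/esym/gP.
have gA a v : g (mod_act P a v) = mod_act N a (g v).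
  by apply: finj; rewrite fg !hom_actE fg.
by exists (mk_hom gA).
Qed.

Lemma lift_surj M N P (f : hom M N) (h : hom M P) :
  (forall w, exists v, vsval f v = w) -> (forall v, vsval f v = 0 -> vsval h v = 0) ->
  exists g : hom N P, forall v, vsval g (vsval f v) = vsval h v.
Proof.
move=> fs fh.
have [|||g gP] := @linfun_of_rel _ N P (fun w x => exists2 v, vsval f v = w & vsval h v = x).
- by move=> w; have [v <-] := fs w; exists (vsval h v); exists v.
- by move=> x [v /fh -> ].
- move=> c u v u' v' [x <- <-] [y <- <-].
  by exists (c *: x + y); rewrite linearP.
have gf v : g (vsval f v) = vsval h v by apply/esym/gP; exists v.
have gA a w : g (mod_act N a w) = mod_act P a (g w).
  by have [v <-] := fs w; rewrite -hom_actE !gf hom_actE.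
by exists (mk_hom gA).
Qed.

Lemma isomorphic_refl M : isomorphic M M.
Proof. by exists (hom_id M), (hom_id M); rewrite hom_comp1l. Qed.

Lemma isomorphic_sym M N : isomorphic M N -> isomorphic N M.
Proof. by case=> f [g [gf fg]]; exists g, f. Qed.

Lemma isomorphic_trans M N P : isomorphic M N -> isomorphic N P -> isomorphic M P.
Proof.
case=> f [g [gf fg]] [f' [g' [gf' fg']]].
exists (hom_comp f' f), (hom_comp g g'); split.
  by rewrite hom_compA -(hom_compA g) gf' hom_comp1r.
by rewrite hom_compA -(hom_compA f') fg hom_comp1r.
Qed.

Lemma bij_isomorphic M N (f : hom M N) :
  injective (vsval f) -> (forall w, exists v, vsval f v = w) -> isomorphic M N.
Proof.
move=> finj fs; have [v|g fg] := @lift_inj _ _ _ f (hom_id N) finj.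
  by have [u <-] := fs v; exists u; rewrite id_lfunE.
exists f, g; split; apply: hom_ext => v; rewrite /= comp_lfunE id_lfunE.
  by apply: finj; rewrite fg id_lfunE.
by rewrite fg id_lfunE.
Qed.

Lemma isomorphicP M N : isomorphic M N -> exists f : hom M N,
  injective (vsval f) /\ forall w, exists v, vsval f v = w.
Proof.
case=> f [g [/(congr1 vsval)/lfunP gf /(congr1 vsval)/lfunP fg]]; exists f; split.
  apply: (can_inj (g := vsval g)) => v; have := gf v.
  by rewrite /= comp_lfunE id_lfunE.
by move=> w; exists (vsval g w); have := fg w; rewrite /= comp_lfunE id_lfunE.
Qed.

Lemma same_img_isomorphic M N P (f : hom M P) (g : hom N P) :
  injective (vsval f) -> injective (vsval g) ->
  (forall v, exists u, vsval f v = vsval g u) ->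
  (forall v, exists u, vsval g v = vsval f u) -> isomorphic M N.
Proof.
move=> finj ginj fg gf.
have [h hP] := lift_inj ginj fg.
apply: (@bij_isomorphic _ _ h) => [u v huv | w].
  by apply: finj; rewrite -!hP huv.
by have [u gu] := gf w; exists u; apply: ginj; rewrite hP.
Qed.

Lemma quotient_mod M (U : {vspace M}) : submodule U ->
  exists (Q : fdmod A) (g : hom M Q),
    (forall w, exists v, vsval g v = w) /\ forall v, vsval g v = 0 <-> v \in U.
Proof.
(* The quotient is carried by a complement [W] of [U], and [p] is the projection onto [W] along
   [U]. *)
move=> sU; pose W := (U^C)%VS; pose E := subvs_of W.
pose p := daddv_pi W U.
have pW v : p v \in W by apply: memv_pi.
have pdec v : v - p v \in U.
  have := @daddv_pi_add _ _ W U v; rewrite capvC capv_compl addvC addv_complf memvf.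
  by move=> /(_ erefl isT) {1}<-; rewrite addrC addKr memv_pi.
have p_id v : v \in W -> p v = v.
  by apply: daddv_pi_id; rewrite capvC capv_compl.
have pU v : v \in U -> p v = 0.
  move=> vU; apply/eqP; rewrite -memv0 -(capv_compl U) memv_cap pW andbT.
  by rewrite -[p v](subKr v) memvB.
pose g : 'Hom(M, E) := linfun (vsproj W \o p).
have gE v : vsval (g v) = p v by rewrite lfunE /= vsprojK.
have g0 v : g v = 0 <-> v \in U.
  split=> [gv|vU]; last by apply: subvs_inj; rewrite gE pU // linear0.
  by move: (pdec v); rewrite -gE gv (_ : vsval 0 = 0) ?subr0.
have gs w : g (vsval w) = w.
  by apply: subvs_inj; rewrite gE p_id // subvsP.
pose act (a : A) : 'End(E) := linfun (g \o mod_act M a \o vsval).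
have actE a v : act a (g v) = g (mod_act M a v).
  rewrite lfunE /= gE; apply/eqP; rewrite -subr_eq0 -!linearB; apply/eqP/g0.
  by rewrite -opprB linearN memvN sU.
have act_lin : linear act.
  move=> c a b; apply/lfunP => w; rewrite -(gs w) add_lfunE scale_lfunE !actE.
  by rewrite linearP /= add_lfunE scale_lfunE linearP.
pose l := GRing.isLinear.Build _ _ _ _ _ act_lin.
pose actl : {linear A -> 'End(E)} := HB.pack act l.
have act1 : actl (alg_one A) = \1%VF.
  by apply/lfunP => w; rewrite -(gs w) /= actE act1E id_lfunE.
have actM a b : actl (alg_mul a b) = (actl a \o actl b)%VF.
  by apply/lfunP => w; rewrite -(gs w) comp_lfunE /= !actE actME.
pose Q := @FdMod k A E actl act1 actM.
have gA a v : (g : 'Hom(M, Q)) (mod_act M a v) = mod_act Q a (g v) by rewrite /= actE.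
exists Q, (mk_hom gA); split=> [w|v]; last exact: g0.
by exists (vsval (w : E)); apply: gs.
Qed.

Lemma submod_incl M (U V : {vspace M}) (sU : submodule U) (sV : submodule V) :
  (U <= V)%VS -> exists f : hom (submod sU) (submod sV),
  forall u : subvs_of U, vsval (vsval f u : subvs_of V) = vsval u.
Proof.
move=> UV; pose f : 'Hom(subvs_of U, subvs_of V) := linfun (vsproj V \o vsval).
have fE u : vsval (f u) = vsval u.
  by rewrite lfunE /= vsprojK // (subvP UV) ?subvsP.
have fA a v : (f : 'Hom(submod sU, submod sV)) (mod_act (submod sU) a v) =
    mod_act (submod sV) a (f v).
  by apply: subvs_inj; rewrite fE /= !submod_actE // fE.
by exists (mk_hom fA).
Qed.

Lemma submod_incl_full M (U : {vspace M}) (sU : submodule U) :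
  exists f : hom (submod sU) M, forall u : subvs_of U, vsval f u = vsval u.
Proof.
pose f : 'Hom(subvs_of U, M) := linfun vsval.
have fE u : f u = vsval u by rewrite lfunE.
have fA a v : (f : 'Hom(submod sU, M)) (mod_act (submod sU) a v) = mod_act M a (f v).
  by rewrite !fE /= !submod_actE.
by exists (mk_hom fA).
Qed.

End Modules.

Arguments submodule_ker {k A M N} f _ _ _.
Arguments submodule_img {k A M N} f U _ _ _ _.
Arguments submodule_full {k A} M _ _ _.

(** * Composition series *)

Section JordanHoelder.
Variables (k : fieldType) (A : fdalg k).
Implicit Types (M N P Q : fdmod A) (S T : simple A) (l : seq (simple A)).

(** Isomorphism is decided classically, so that factors in a list can be counted. *)
Definition isob S T : bool :=
  if excluded_middle_informative (isomorphic S T) then true else false.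

Lemma isobP S T : reflect (isomorphic S T) (isob S T).
Proof. by rewrite /isob; case: excluded_middle_informative => H; constructor. Qed.

Lemma isob_sym S T : isob S T = isob T S.
Proof. by apply/isobP/isobP; apply: isomorphic_sym. Qed.

Lemma isob_eqr S S' T : isob S S' -> isob T S = isob T S'.
Proof.
move/isobP => SS'; apply/isobP/isobP => TS; first exact: isomorphic_trans SS'.
by apply: isomorphic_trans (isomorphic_sym SS').
Qed.

Lemma isob_eql S S' T : isob S S' -> isob S T = isob S' T.
Proof. by move=> SS'; rewrite isob_sym (isob_eqr _ SS') isob_sym. Qed.

Definition mult S l : nat := count (fun T => isob T S) l.

Lemma mult_iso S T l : isomorphic S T -> mult S l = mult T l.
Proof. by move/isobP => ST; apply: eq_count => X; apply: isob_eqr. Qed.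

(* The list runs from the top of [M] down to its socle. *)
Fixpoint comp_series l M : Prop :=
  if l is T :: l' then
    exists M' (f : hom M' M) (g : hom M T), short_exact f g /\ comp_series l' M'
  else zero_mod M.

Lemma comp_series_jh_mult S l M : comp_series l M -> jh_mult S M (mult S l).
Proof.
elim: l M => [|T l IH] M /=; first exact: jh_mult_0.
case=> M' [f [g [fg /IH HM']]]; rewrite /mult /=.
case: isobP => TS; [exact: jh_mult_iso fg TS HM' | exact: jh_mult_noniso fg TS HM'].
Qed.

Lemma jh_mult_comp_series S M n : jh_mult S M n ->
  exists2 l, comp_series l M & mult S l = n.
Proof.
elim=> {M n} [M M0 | M' M T f g n fg TS _ [l lM <-] | M' M T f g n fg TS _ [l lM <-]].
- by exists [::].
- by exists (T :: l); [exists M', f, g | rewrite /mult /=; move/isobP: TS => ->].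
- by exists (T :: l); [exists M', f, g | rewrite /mult /=; move/isobP/negbTE: TS => ->].
Qed.

Lemma comp_series_iso l M N : isomorphic M N -> comp_series l M -> comp_series l N.
Proof.
case: l => [|T l] MN /=.
  move=> /zero_modP M0; apply/zero_modP => v.
  have [f [_ fs]] := isomorphicP MN; have [u <-] := fs v.
  by rewrite (M0 u) linear0.
case=> M' [f [g [/short_exactP [finj fg gs] lM']]].
have [h [hinj hs]] := isomorphicP MN.
have [h' [h'inj h's]] := isomorphicP (isomorphic_sym MN).
have [g' g'P] : exists g' : hom N T, forall v, vsval g' (vsval h v) = vsval g v.
  by apply: lift_surj => // v; rewrite -[0](linear0 (vsval h)) => /hinj ->; rewrite linear0.
exists M', (hom_comp h f), g'; split => //; apply/short_exactP; split.
- by move=> u v /=; rewrite !comp_lfunE => /hinj/finj.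
- move=> v; have [u <-] := hs v; rewrite g'P fg; split=> -[w].
    by move=> ->; exists w; rewrite /= comp_lfunE.
  by rewrite /= comp_lfunE => /hinj; exists w.
- by move=> w; have [v <-] := gs w; exists (vsval h v); rewrite g'P.
Qed.

Lemma simple_ker M T (g : hom T M) : vsval g = 0 \/ injective (vsval g).
Proof.
have [_ /(_ _ (submodule_ker g)) [g0|gf]] := simpleP T.
  by right; apply/lker0P; rewrite g0.
by left; apply/lfunP => v; rewrite zero_lfunE; apply/eqP; rewrite -memv_ker gf memvf.
Qed.

Lemma simple_img M T (g : hom M T) :
  vsval g = 0 \/ forall w, exists v, vsval g v = w.
Proof.
have [_ /(_ _ (submodule_img g _ (submodule_full M)))] := simpleP T.
case=> [g0|gf]; [left | right].
  apply/lfunP => v; rewrite zero_lfunE; apply/eqP; rewrite -memv0 -g0.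
  by rewrite memv_img ?memvf.
move=> w; have : w \in limg (vsval g) by rewrite gf memvf.
by case/memv_imgP => v _ ->; exists v.
Qed.

Lemma schur S T (g : hom S T) : vsval g = 0 \/ isomorphic S T.
Proof.
have [g0|gi] := simple_ker g; first by left.
have [g0|gs] := simple_img g; first by left.
by right; apply: bij_isomorphic gi gs.
Qed.

Lemma simple_neq0 S : ~ forall v : S, v = 0.
Proof. by move/zero_modP; case: (simpleP S). Qed.

Lemma short_exact_dim M N P (f : hom M N) (g : hom N P) :
  short_exact f g -> \dim {:N} = (\dim {:M} + \dim {:P})%N.
Proof.
case=> f0 fg gs; rewrite -(limg_ker_dim (vsval g) fullv) capfv gs -fg.
by rewrite limg_dim_eq // f0 capv0.
Qed.

Lemma short_exact_ker M N (g : hom M N) : (forall w, exists v, vsval g v = w) ->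
  exists2 f : hom (submod (submodule_ker g)) M, short_exact f g &
    forall u : subvs_of (lker (vsval g)), vsval f u = vsval u.
Proof.
move=> gs; have [f fE] := submod_incl_full (submodule_ker g).
exists f => //; apply/short_exactP; split=> // [u v|v].
  by rewrite !fE => /subvs_inj.
split=> [/eqP|[u ->]]; last by apply/eqP; rewrite fE -memv_ker subvsP.
by rewrite -memv_ker => vk; exists (Subvs vk); rewrite fE.
Qed.

Lemma simple_dim_gt0 S : (0 < \dim {:S})%N.
Proof. by rewrite lt0n; apply/eqP; case: (simpleP S). Qed.

(** If [M] is not simple, a proper nonzero submodule yields a nonzero quotient of smaller dimension,
    and a simple quotient of that one will do. *)
Lemma simple_quotient M : ~ zero_mod M ->
  exists (T : simple A) (g : hom M T), forall w, exists v, vsval g v = w.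
Proof.
move: {2}(\dim {:M}) (leqnn (\dim {:M})) => n; elim: n M => [|n IH] M Mn M0.
  by case: M0; apply/eqP; rewrite -leqn0.
case: (classic (simple_mod M)) => [sM | nsM].
  exists (Simple sM), (hom_id M) => w; exists w; exact: id_lfunE.
have [U [sU U0 Uf]] : exists U : {vspace M}, [/\ submodule U, U <> 0%VS & U <> fullv].
  apply: NNPP => H; apply: nsM; split=> // U sU; apply: NNPP => /not_or_and [U0 Uf].
  by apply: H; exists U.
have [Q [g [gs gk]]] := quotient_mod sU.
have kgU : lker (vsval g) = U.
  by apply/vspaceP => v; rewrite memv_ker; apply/eqP/idP => /gk.
have := limg_ker_dim (vsval g) fullv; rewrite capfv kgU.
have -> : limg (vsval g) = fullv.
  apply/vspaceP => w; rewrite memvf; have [v <-] := gs w.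
  by rewrite memv_img ?memvf.
have : (0 < \dim U)%N by rewrite lt0n dimv_eq0; apply/eqP.
move=> dU dQ; have [||T [h hs]] := IH Q.
- by lia.
- move/zero_modP => Q0; apply: Uf; apply/vspaceP => v; rewrite memvf; apply/gk.
  exact: Q0.
exists T, (hom_comp h g) => w; have [x <-] := hs w; have [v <-] := gs x.
by exists v; rewrite /= comp_lfunE.
Qed.

Lemma comp_series_exists M : exists l, comp_series l M.
Proof.
move: {2}(\dim {:M}) (leqnn (\dim {:M})) => n; elim: n M => [|n IH] M Mn.
  by exists [::]; apply/eqP; rewrite -leqn0.
case: (classic (zero_mod M)) => M0; first by exists [::].
have [T [g gs]] := simple_quotient M0.
have [f fg _] := short_exact_ker gs.
have [|l lP] := IH (submod (submodule_ker g)).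
  have := short_exact_dim fg; have := simple_dim_gt0 T; lia.
by exists (T :: l), (submod (submodule_ker g)), f, g.
Qed.

(** Jordan-Hoelder, by induction on the dimension. If the maximal submodules [M1] and [M2] coincide,
    the induction hypothesis compares the rests. Otherwise their intersection has quotient [T2] in
    [M1] and [T1] in [M2], and one series of the intersection is compared with both. *)
Lemma comp_series_mult l1 l2 M S :
  comp_series l1 M -> comp_series l2 M -> mult S l1 = mult S l2.
Proof.
move: {2}(\dim {:M}) (leqnn (\dim {:M})) => n.
elim: n l1 l2 M S => [|n IH] l1 l2 M S Mn.
  have M0 : zero_mod M by apply/eqP; rewrite -leqn0.
  have H l : comp_series l M -> l = [::].
    case: l => //= T l [M' [f [g [/short_exact_dim]]]]; rewrite M0.
    by have := simple_dim_gt0 T; lia.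
  by move=> /H -> /H ->.
case: l1 => [|T1 l1] /=.
  case: l2 => //= T l M0 [M' [f [g [/short_exact_dim]]]]; rewrite M0.
  by have := simple_dim_gt0 T; lia.
case: l2 => [|T2 l2] /=.
  move=> [M' [f [g [/short_exact_dim]]]] + _ M0; rewrite M0.
  by have := simple_dim_gt0 T1; lia.
move=> [M1 [f1 [g1 [E1 lM1]]]] [M2 [f2 [g2 [E2 lM2]]]].
have d1 : (\dim {:M1} <= n)%N.
  by have := short_exact_dim E1; have := simple_dim_gt0 T1; lia.
have d2 : (\dim {:M2} <= n)%N.
  by have := short_exact_dim E2; have := simple_dim_gt0 T2; lia.
have [f1i fg1 g1s] := proj1 (short_exactP _ _) E1.
have [f2i fg2 g2s] := proj1 (short_exactP _ _) E2.
(* If [g2] vanishes on [M1], then [g2] factors through [T1]; by Schur's lemma the factor is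
   injective, so both maps have the same kernel. *)
have [h0|hs] := simple_img (hom_comp g2 f1).
  have sub12 v : vsval g1 v = 0 -> vsval g2 v = 0.
    by move/fg1 => [u ->]; move/lfunP/(_ u): h0; rewrite /= comp_lfunE zero_lfunE.
  have [h hP] := lift_surj g1s sub12.
  have [h0'|TT] := schur h.
    case: (@simple_neq0 T2) => w; have [v <-] := g2s w.
    by rewrite -hP h0' zero_lfunE.
  have hi : injective (vsval h).
    have [h0'|//] := simple_ker h.
    case: (@simple_neq0 T2) => w; have [v <-] := g2s w.
    by rewrite -hP h0' zero_lfunE.
  have sub21 v : vsval g2 v = 0 -> vsval g1 v = 0.
    by rewrite -hP -[in X in X -> _](linear0 (vsval h)) => /hi.
  have MM : isomorphic M2 M1.
    apply: (@same_img_isomorphic _ _ _ _ _ f2 f1) => // v.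
      by have /fg1 [u ->] : vsval g1 (vsval f2 v) = 0; [apply/sub21/fg2; exists v | exists u].
    by have /fg2 [u ->] : vsval g2 (vsval f1 v) = 0; [apply/sub12/fg1; exists v | exists u].
  rewrite /mult /= (isob_eql _ (introT (isobP _ _) TT)); congr (_ + _)%N.
  exact: IH d1 lM1 (comp_series_iso MM lM2).
(* Here [M2] would lie in [M1], and [g1] would factor through an injective map on [T2]. But [T2] is
   the image of [M1], on which [g1] is zero, so [T2] would be zero. *)
have [h0|hs'] := simple_img (hom_comp g1 f2).
  have sub21 v : vsval g2 v = 0 -> vsval g1 v = 0.
    by move/fg2 => [u ->]; move/lfunP/(_ u): h0; rewrite /= comp_lfunE zero_lfunE.
  have [h hP] := lift_surj g2s sub21.
  have hi : injective (vsval h).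
    have [h0'|//] := simple_ker h.
    case: (@simple_neq0 T1) => w; have [v <-] := g1s w.
    by rewrite -hP h0' zero_lfunE.
  case: (@simple_neq0 T2) => w; have [v <-] := hs w; rewrite /= comp_lfunE.
  apply: hi; rewrite hP linear0; apply/fg1; by exists v.
(* Both kernels are the intersection of [M1] and [M2], seen once inside [M1] and once inside
   [M2]. *)
have [a1 e1 a1E] := short_exact_ker hs.
have [a2 e2 a2E] := short_exact_ker hs'.
set N1 := submod _ in a1 e1 a1E; set N2 := submod _ in a2 e2 a2E.
have [a1i fa1 _] := proj1 (short_exactP _ _) e1.
have [a2i fa2 _] := proj1 (short_exactP _ _) e2.
have NN : isomorphic N1 N2.
  apply: (@same_img_isomorphic _ _ _ _ _ (hom_comp f1 a1) (hom_comp f2 a2)).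
  - by move=> u v; rewrite /= !comp_lfunE => /f1i/a1i.
  - by move=> u v; rewrite /= !comp_lfunE => /f2i/a2i.
  - move=> v; have : vsval (hom_comp g2 f1) (vsval a1 v) = 0 by apply/fa1; exists v.
    rewrite /= !comp_lfunE => /fg2 [u eu].
    have : vsval (hom_comp g1 f2) u = 0.
      by rewrite /= comp_lfunE -eu; apply/fg1; exists (vsval a1 v).
    by move/fa2 => [w ew]; exists w; rewrite comp_lfunE -ew.
  - move=> v; have : vsval (hom_comp g1 f2) (vsval a2 v) = 0 by apply/fa2; exists v.
    rewrite /= !comp_lfunE => /fg1 [u eu].
    have : vsval (hom_comp g2 f1) u = 0.
      by rewrite /= comp_lfunE -eu; apply/fg2; exists (vsval a2 v).
    by move/fa1 => [w ew]; exists w; rewrite comp_lfunE -ew.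
have [l lN] := comp_series_exists N1.
have c1 : comp_series (T2 :: l) M1 by exists N1, a1, (hom_comp g2 f1).
have c2 : comp_series (T1 :: l) M2.
  by exists N2, a2, (hom_comp g1 f2); split=> //; apply: comp_series_iso lN.
have := IH _ _ _ S d1 lM1 c1; have := IH _ _ _ S d2 lM2 c2.
by rewrite /mult /=; lia.
Qed.

End JordanHoelder.

Section RegularModule.
Variables (k : fieldType) (A : fdalg k).

Definition regular_act (a : A) : 'End(A) := linfun (alg_mul a).

Lemma regular_act_apply a b : regular_act a b = alg_mul a b.
Proof. by rewrite /regular_act linfun_apply //; apply: alg_mul_linr. Qed.

Lemma regular_act_is_linear : linear regular_act.
Proof.
move=> c a b; apply/lfunP => w.
by rewrite add_lfunE scale_lfunE !regular_act_apply alg_mul_linl.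
Qed.
HB.instance Definition _ :=
  GRing.isLinear.Build k A 'End(A) _ regular_act regular_act_is_linear.

Lemma regular_act1 : regular_act (alg_one A) = \1%VF.
Proof. by apply/lfunP => w; rewrite regular_act_apply id_lfunE alg_mul1l. Qed.

Lemma regular_actM a b :
  regular_act (alg_mul a b) = (regular_act a \o regular_act b)%VF.
Proof. by apply/lfunP => w; rewrite comp_lfunE !regular_act_apply alg_mulA. Qed.

Definition regular_mod : fdmod A := @FdMod k A A regular_act regular_act1 regular_actM.

Lemma regular_actE (a b : A) : mod_act regular_mod a b = alg_mul a b.
Proof. exact: regular_act_apply. Qed.

End RegularModule.

(** * Dimension vectors and the additive invariants that they determine *)

Section DimensionVectors.
Variables (k : fieldType) (A : fdalg k).
Implicit Types (M N P Q : fdmod A) (S T : simple A) (l : seq (simple A)).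

Lemma regular_hom M (m : M) :
  exists f : hom (regular_mod A) M, forall a : A, vsval f a = mod_act M a m.
Proof.
pose f : 'Hom(A, M) := linfun (fun a : A => mod_act M a m).
have fE a : f a = mod_act M a m.
  by rewrite linfun_apply // => c x y; rewrite linearP add_lfunE scale_lfunE.
have fA a v : (f : 'Hom(regular_mod A, M)) (mod_act (regular_mod A) a v) = mod_act M a (f v).
  by rewrite regular_actE !fE actME.
by exists (mk_hom fA).
Qed.

(** Either [g] is nonzero on the first submodule of the series, or it factors through the top factor
    [T] and Schur's lemma identifies [S] with [T]. *)
Lemma simple_quotient_in l M S (g : hom M S) :
  comp_series l M -> vsval g <> 0 -> has (isob S) l.
Proof.
elim: l M g => [|T l IH] M g /=.
  by move/zero_modP => M0; case; apply/lfunP => v; rewrite (M0 v) !linear0.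
case=> M' [f [h [/short_exactP [fi fh hs] lM']]] g0.
case: (classic (vsval (hom_comp g f) = 0)) => [gf0|gf]; last first.
  by rewrite (IH _ (hom_comp g f)) ?orbT.
have [v /fh [u ->]|h' h'P] := @lift_surj _ _ _ _ _ h g hs.
  by move/lfunP/(_ u): gf0; rewrite /= comp_lfunE zero_lfunE.
apply/orP; left; have [h0|/isobP TS] := schur h'; last by rewrite isob_sym.
by case: g0; apply/lfunP => v; rewrite -h'P h0 !zero_lfunE.
Qed.

(** Every simple module is a quotient of the regular module, hence occurs in a fixed composition
    series of it. The finite system obtained by removing repetitions is what [total_dim] asks
    for. *)
Lemma simple_reps : exists (r : nat) (ss : 'I_r -> simple A),
  forall S, exists! i, isomorphic S (ss i).
Proof.
have [l lP] := comp_series_exists (regular_mod A).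
have cover S : has (isob S) l.
  have [m m0] : exists m : S, m <> 0.
    by apply: NNPP => H; apply: (@simple_neq0 _ _ S) => m; apply: NNPP => m0; apply: H; exists m.
  have [f fE] := regular_hom m; apply: simple_quotient_in (f) lP _ => /lfunP/(_ (alg_one A)).
  by rewrite fE act1E zero_lfunE.
have [s sP su] : exists2 s, (forall S, has (isob S) l -> has (isob S) s) &
    pairwise (fun S T => ~~ isob S T) s.
  elim: {cover lP} l => [|T l [s sP su]]; first by exists [::].
  have [Ts|Ts] := boolP (has (isob T) s).
    exists s => // S /= /orP [ST|/sP //].
    by rewrite (@eq_has _ (isob S) (isob T)) // => X; rewrite (isob_eql _ ST).
  exists (T :: s) => [S /= /orP [->//|/sP ->]|/=]; first by rewrite orbT.
  by rewrite su andbT all_predC.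
(* The list is empty when there are no simple modules, as over the zero algebra; otherwise its head
   serves as default for [nth]. *)
case: s sP su => [|T0 s] sP su.
  have noS S : False by have := sP S (cover S).
  have [f _] : exists f : 'I_0 -> simple A, True.
    by exists (fun i : 'I_0 => False_rect _ (notF (ltn_ord i : (i < 0)%N = true))).
  by exists 0%N, f => S; case: (noS S).
set s' := T0 :: s in sP su; exists (size s'), (fun i => nth T0 s' i) => S.
have /sP/(has_nthP T0) [i lti Si] := cover S.
exists (Ordinal lti); split; first exact/isobP.
move=> j /isobP Sj; apply: val_inj => /=.
have ij : isob (nth T0 s' i) (nth T0 s' j) by rewrite -(isob_eql _ Si).
have /(pairwiseP T0) pw := su.
case: (ltngtP i j) => // [lt|lt].
  by have := pw _ _ lti (ltn_ord j) lt; rewrite ij.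
by have := pw _ _ (ltn_ord j) lti lt; rewrite isob_sym ij.
Qed.

Lemma sum_mult r (ss : 'I_r -> simple A) (w : simple A -> nat) l :
  (forall S, exists! i, isomorphic S (ss i)) ->
  (forall S T, isomorphic S T -> w S = w T) ->
  (\sum_(T <- l) w T = \sum_(i < r) mult (ss i) l * w (ss i))%N.
Proof.
move=> ssP wiso; elim: l => [|T l IH].
  by rewrite big_nil big1.
rewrite big_cons IH.
under [RHS]eq_bigr do rewrite /mult /= mulnDl.
rewrite big_split /=; congr (_ + _)%N.
have [i [Ti iu]] := ssP T; rewrite (bigD1 i) //= (introT (isobP _ _) Ti) mul1n.
rewrite big1 ?addn0; first exact: wiso.
move=> j ji; case: isobP => [/iu ij|]; last by rewrite mul0n.
by rewrite ij eqxx in ji.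
Qed.

Definition dimvec_of l : dimvec A := DimVec (fun S T => @mult_iso _ _ S T l).

Lemma has_dimvec_of l M : comp_series l M -> has_dimvec M (dimvec_of l).
Proof. by move=> lM S; apply: comp_series_jh_mult. Qed.

(** [has_dimvec] may use another composition series for each simple module. By Jordan-Hoelder a
    single series serves all of them, so additive invariants of [M] can be computed from [l]. *)
Lemma has_dimvec_sum l M (w : simple A -> nat) :
  (forall S T, isomorphic S T -> w S = w T) -> has_dimvec M (dimvec_of l) ->
  exists2 l', comp_series l' M & (\sum_(T <- l') w T = \sum_(T <- l) w T)%N.
Proof.
move=> wiso lM; have [l' l'M] := comp_series_exists M; exists l' => //.
have [r [ss ssP]] := simple_reps.
rewrite !(sum_mult _ ssP wiso); apply: eq_bigr => i _; congr (_ * _)%N.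
have [l'' l''M el] := jh_mult_comp_series (lM (ss i)).
rewrite -[mult (ss i) l]el; exact: comp_series_mult l''M.
Qed.

Lemma isomorphic_dim M N : isomorphic M N -> \dim {:M} = \dim {:N}.
Proof.
move=> /isomorphicP [f [/lker0P/eqP fi fs]].
rewrite -(limg_ker_dim (vsval f) {:M}) capfv fi dimv0 add0n; congr (\dim _).
apply/vspaceP => w; rewrite memvf; have [v <-] := fs w; by rewrite memv_img ?memvf.
Qed.

Lemma total_dim_of l : total_dim (dimvec_of l) (\sum_(T <- l) \dim {:T})%N.
Proof.
have [r [ss ssP]] := simple_reps; exists r, ss; split => //.
by rewrite (@sum_mult _ ss (fun T => \dim {:T}) l ssP) // => S T /isomorphic_dim.
Qed.

(** For an idempotent [b] this is the dimension of bM, which depends exactly on [M]; it is the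
    invariant through which a dimension vector controls a submodule. *)
Definition act_rank (b : A) M : nat := \dim (limg (mod_act M b)).

(** Idempotency gives exactness in the middle: if b n = f u, then b n = b (b n) = f (b u). *)
Lemma act_rank_short_exact (b : A) M N P (f : hom M N) (g : hom N P) :
  alg_mul b b = b -> short_exact f g ->
  act_rank b N = (act_rank b M + act_rank b P)%N.
Proof.
move=> bb /short_exactP [fi fg gs]; rewrite /act_rank.
rewrite -(limg_ker_dim (vsval g) (limg (mod_act N b))); congr (_ + _)%N.
  rewrite -(@limg_dim_eq _ _ _ (vsval f) (limg (mod_act M b))); last first.
    by move/lker0P/eqP: fi => ->; rewrite capv0.
  congr (\dim _); apply/vspaceP => x; rewrite memv_cap memv_ker.
  apply/andP/idP => [[/memv_imgP [n _ ->] /eqP/fg [u eu]]|].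
    apply/memv_imgP; exists (mod_act M b u); first by rewrite memv_img ?memvf.
    by rewrite hom_actE -eu -actME bb.
  case/memv_imgP => _ /memv_imgP [u _ ->] ->; rewrite hom_actE memv_img ?memvf //.
  by split=> //; apply/eqP; rewrite hom_actE (proj2 (fg _)) ?linear0 //; exists u.
congr (\dim _); apply/vspaceP => x; apply/memv_imgP/memv_imgP.
  case=> _ /memv_imgP [n _ ->] ->; exists (vsval g n); rewrite ?memvf //.
  by rewrite hom_actE.
case=> w _ ->; have [v <-] := gs w; exists (mod_act N b v); last by rewrite hom_actE.
by rewrite memv_img ?memvf.
Qed.

Lemma act_rank_iso (b : A) M N : isomorphic M N -> act_rank b M = act_rank b N.
Proof.
case/isomorphicP => f [fi fs]; rewrite /act_rank.
rewrite -(@limg_dim_eq _ _ _ (vsval f) (limg (mod_act M b))); last first.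
  by move/lker0P/eqP: fi => ->; rewrite capv0.
congr (\dim _); apply/vspaceP => x; apply/memv_imgP/memv_imgP.
  case=> _ /memv_imgP [n _ ->] ->; exists (vsval f n); rewrite ?memvf //.
  by rewrite hom_actE.
case=> w _ ->; have [v <-] := fs w; exists (mod_act M b v); last by rewrite hom_actE.
by rewrite memv_img ?memvf.
Qed.

Lemma act_rank_comp_series (b : A) l M : alg_mul b b = b -> comp_series l M ->
  act_rank b M = (\sum_(T <- l) act_rank b T)%N.
Proof.
move=> bb; elim: l M => [|T l IH] M /=.
  move=> /zero_modP M0; rewrite big_nil; apply/eqP; rewrite dimv_eq0 -subv0.
  by apply/subvP => v _; rewrite (M0 v) mem0v.
case=> M' [f [g [fg /IH HM']]].
by rewrite big_cons (act_rank_short_exact bb fg) HM' addnC.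
Qed.

Lemma has_dimvec_act_rank (b : A) l M : alg_mul b b = b ->
  has_dimvec M (dimvec_of l) -> act_rank b M = (\sum_(T <- l) act_rank b T)%N.
Proof.
move=> bb /(has_dimvec_sum (@act_rank_iso b)) [l' l'M <-].
exact: act_rank_comp_series.
Qed.

Lemma comp_series_dim l M : comp_series l M -> \dim {:M} = (\sum_(T <- l) \dim {:T})%N.
Proof.
elim: l M => [|T l IH] M /=; first by rewrite big_nil.
case=> M' [f [g [/short_exact_dim -> /IH ->]]].
by rewrite big_cons addnC.
Qed.

End DimensionVectors.

(** * One-dimensional simple modules given by characters *)

Section CharacterModule.
Variables (k : fieldType) (A : fdalg k) (chi : {linear A -> k^o}).
Hypotheses (chi1 : chi (alg_one A) = 1)
  (chiM : forall a b, chi (alg_mul a b) = chi a * chi b).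

Definition char_act (a : A) : 'End(k^o) := chi a *: \1%VF.

Lemma char_act_is_linear : linear char_act.
Proof. by move=> c a b; rewrite /char_act linearP scalerDl scalerA. Qed.
HB.instance Definition _ :=
  GRing.isLinear.Build k A 'End(k^o) _ char_act char_act_is_linear.

Lemma char_act1 : char_act (alg_one A) = \1%VF.
Proof. by rewrite /char_act chi1 scale1r. Qed.

Lemma char_actM a b : char_act (alg_mul a b) = (char_act a \o char_act b)%VF.
Proof.
by rewrite /char_act chiM -comp_lfunZl -comp_lfunZr comp_lfun1l scalerA.
Qed.

Definition char_mod : fdmod A := @FdMod k A k^o char_act char_act1 char_actM.

Lemma char_mod_actE a (x : char_mod) : mod_act char_mod a x = chi a * (x : k).
Proof. by rewrite /= /char_act scale_lfunE id_lfunE. Qed.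

Lemma char_mod_dim : \dim {:char_mod} = 1%N.
Proof. by rewrite dimvf. Qed.

Lemma char_mod_simple : simple_mod char_mod.
Proof.
split; first by rewrite /zero_mod char_mod_dim.
move=> U _; case: (leqP (\dim U) 0) => [|d].
  by rewrite leqn0 dimv_eq0 => /eqP ->; left.
by right; apply/eqP; rewrite eqEdim subvf char_mod_dim.
Qed.

Definition char_simple : simple A := Simple char_mod_simple.

Lemma act_rank_char (b : A) : act_rank b char_simple = (chi b != 0).
Proof.
rewrite /act_rank; have [b0|b0] := eqVneq (chi b) 0.
  apply/eqP; rewrite dimv_eq0 -subv0; apply/subvP => _ /memv_imgP [x _ ->].
  by rewrite char_mod_actE b0 mul0r mem0v.
transitivity (\dim {:char_mod}); last exact: char_mod_dim.
congr (\dim _); apply/vspaceP => x; rewrite memvf.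
apply/memv_imgP; exists ((chi b)^-1 * (x : k)); rewrite ?memvf //.
by rewrite char_mod_actE mulrA divff // mul1r.
Qed.

(** Modulo [U] the space [V] is spanned by [v0], an eigenvector with eigenvalues [chi]; the map to
    [char_mod] is the coefficient of [v0]. *)
Lemma char_extension (M : fdmod A) (U V : {vspace M}) (sU : submodule U)
    (sV : submodule V) (v0 : M) :
  (U <= V)%VS -> v0 \in V -> v0 \notin U -> (V <= U + <[v0]>)%VS ->
  (forall a, mod_act M a v0 - chi a *: v0 \in U) ->
  exists (f : hom (submod sU) (submod sV)) (g : hom (submod sV) char_mod),
    short_exact f g.
Proof.
move=> UV v0V v0U VU chiP; have [f fE] := submod_incl sU sV UV; exists f.
have [||c u v u' v' Ru Rv|g gP] := @linfun_of_rel _ (subvs_of V) k^o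
  (fun v x => vsval v - (x : k) *: v0 \in U).
- move=> v; have /memv_addP [u uU [_ /vlineP [x ->] vE]] := subvP VU _ (subvsP v).
  by exists x; rewrite vE addrK.
- move=> x; rewrite linear0 sub0r memvN => xU; apply/eqP; apply: contraNT v0U => x0.
  by rewrite -[v0]scale1r -(mulVf x0) -scalerA memvZ.
- rewrite linearP /= scalerDl -scalerA opprD addrACA -scalerBr.
  by rewrite memvD ?memvZ.
have gV (v : subvs_of V) : vsval v - (g v : k) *: v0 \in U by apply/gP.
have gA a v : (g : 'Hom(submod sV, char_mod)) (mod_act (submod sV) a v) = mod_act char_mod a (g v).
  rewrite char_mod_actE; apply/esym/gP; rewrite /= submod_actE //.
  have E (x : k) w : mod_act M a w - (chi a * x) *: v0 =
      mod_act M a (w - x *: v0) + x *: (mod_act M a v0 - (chi a : k) *: v0).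
    rewrite lfB lfZ.
    by rewrite scalerBr addrA subrK scalerA mulrC.
  rewrite E; apply: memvD; first exact: sU (gV v).
  by apply: memvZ; apply: chiP.
exists (mk_hom gA); apply/short_exactP; split.
- by move=> u v /(congr1 vsval); rewrite !fE => /subvs_inj.
- move=> v; split=> [gv|[u ->]].
    have vU : vsval (v : subvs_of V) \in U by have := gV v; rewrite [g v]gv scale0r subr0.
    by exists (Subvs vU); apply: subvs_inj; rewrite fE.
  by apply/esym/gP; rewrite scale0r subr0 fE subvsP.
- move=> x; exists (vsproj V ((x : k) *: v0)).
  by apply/esym/gP; rewrite vsprojK ?memvZ // subrr mem0v.
Qed.

End CharacterModule.

(** * Controlled wild algebras *)

Section DirectSum.
Variables (k : fieldType) (A : fdalg k) (M N : fdmod A).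

Definition dsum_act (a : A) : 'End((M * N)%type : vectType k) :=
  linfun (fun x : M * N => (mod_act M a x.1, mod_act N a x.2)).

Lemma dsum_actE a x : dsum_act a x = (mod_act M a x.1, mod_act N a x.2).
Proof.
rewrite /dsum_act linfun_apply // => c [x1 x2] [y1 y2] /=.
by apply: (congr2 pair); rewrite /= !lfD !lfZ.
Qed.

Lemma dsum_act_is_linear : linear dsum_act.
Proof.
move=> c a b; apply/lfunP => x; rewrite add_lfunE scale_lfunE !dsum_actE.
by apply: (congr2 pair); rewrite /= linearP add_lfunE scale_lfunE.
Qed.
HB.instance Definition _ :=
  GRing.isLinear.Build k A 'End((M * N)%type : vectType k) _ dsum_act dsum_act_is_linear.

Lemma dsum_act1 : dsum_act (alg_one A) = \1%VF.
Proof. by apply/lfunP => -[x y]; rewrite dsum_actE id_lfunE /= !act1E. Qed.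

Lemma dsum_actM a b : dsum_act (alg_mul a b) = (dsum_act a \o dsum_act b)%VF.
Proof. by apply/lfunP => x; rewrite comp_lfunE !dsum_actE /= !actME. Qed.

Definition dsum : fdmod A := @FdMod k A (M * N)%type dsum_act dsum_act1 dsum_actM.

Lemma dsum_biproduct : is_biproduct dsum M N.
Proof.
pose i1 : 'Hom(M, dsum) := linfun (fun x : M => (x, 0 : N)).
pose i2 : 'Hom(N, dsum) := linfun (fun x : N => (0 : M, x)).
pose p1 : 'Hom(dsum, M) := linfun (fun x : M * N => x.1).
pose p2 : 'Hom(dsum, N) := linfun (fun x : M * N => x.2).
have i1E x : i1 x = (x, 0 : N).
  have fl : linear (fun x : M => (x, 0 : N)).
    by move=> c u v; apply: (congr2 pair); rewrite /= ?scaler0 ?addr0.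
  by rewrite linfun_apply.
have i2E x : i2 x = (0 : M, x).
  have fl : linear (fun x : N => (0 : M, x)).
    by move=> c u v; apply: (congr2 pair); rewrite /= ?scaler0 ?addr0.
  by rewrite linfun_apply.
have p1E x : p1 x = x.1.
  have fl : linear (fun x : M * N => x.1) by move=> c [u1 u2] [v1 v2].
  by rewrite linfun_apply.
have p2E x : p2 x = x.2.
  have fl : linear (fun x : M * N => x.2) by move=> c [u1 u2] [v1 v2].
  by rewrite linfun_apply.
have i1A a x : i1 (mod_act M a x) = mod_act dsum a (i1 x).
  by rewrite !i1E /= dsum_actE /= linear0.
have i2A a x : i2 (mod_act N a x) = mod_act dsum a (i2 x).
  by rewrite !i2E /= dsum_actE /= linear0.
have p1A a x : p1 (mod_act dsum a x) = mod_act M a (p1 x).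
  by rewrite !p1E /= dsum_actE.
have p2A a x : p2 (mod_act dsum a x) = mod_act N a (p2 x).
  by rewrite !p2E /= dsum_actE.
exists (mk_hom i1A), (mk_hom i2A), (mk_hom p1A), (mk_hom p2A).
split; apply: hom_ext => x; rewrite /= ?comp_lfunE ?id_lfunE.
- by rewrite i1E p1E.
- by rewrite i2E p2E.
- by rewrite i2E p1E zero_lfunE.
- by rewrite i1E p2E zero_lfunE.
- rewrite add_lfunE !comp_lfunE /= i1E i2E p1E p2E; case: x => x y /=.
  by apply: (congr2 pair); rewrite /= ?addr0 ?add0r.
Qed.

End DirectSum.

(** * Maps factoring through the additive closure of a class *)

Section FactorsThrough.
Variables (k : fieldType) (A : fdalg k) (C : fdmod A -> Prop).
Implicit Types X Y P Q : fdmod A.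

Lemma add_closure_dsum P Q :
  add_closure C P -> add_closure C Q -> add_closure C (dsum P Q).
Proof. exact: add_closure_sum (dsum_biproduct P Q). Qed.

Lemma factors_sum P Q X Y (g : hom P Y) (f : hom X P) (g' : hom Q Y) (f' : hom X Q) :
  exists (g'' : hom (dsum P Q) Y) (f'' : hom X (dsum P Q)),
    hom_comp g f + hom_comp g' f' = hom_comp g'' f''.
Proof.
have [i1 [i2 [p1 [p2 [e1 e2 e12 e21 _]]]]] := dsum_biproduct P Q.
exists (hom_comp g p1 + hom_comp g' p2), (hom_comp i1 f + hom_comp i2 f').
apply: hom_ext => x.
have E1 v : vsval p1 (vsval i1 v) = v.
  by move/(congr1 (fun h : hom P P => vsval h v)): e1; rewrite /= comp_lfunE id_lfunE.
have E2 v : vsval p2 (vsval i2 v) = v.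
  by move/(congr1 (fun h : hom Q Q => vsval h v)): e2; rewrite /= comp_lfunE id_lfunE.
have E12 v : vsval p1 (vsval i2 v) = 0.
  by move/(congr1 (fun h : hom Q P => vsval h v)): e12; rewrite /= comp_lfunE zero_lfunE.
have E21 v : vsval p2 (vsval i1 v) = 0.
  by move/(congr1 (fun h : hom P Q => vsval h v)): e21; rewrite /= comp_lfunE zero_lfunE.
rewrite /= !comp_lfunE !add_lfunE !comp_lfunE !lfD E1 E2 E12 E21.
by rewrite !linear0 addr0 add0r.
Qed.

Lemma zero_mod_exists X : exists Z : fdmod A, zero_mod Z.
Proof.
have s0 : submodule (0%VS : {vspace X}).
  by move=> a u; rewrite !memv0 => /eqP ->; rewrite linear0.
exists (submod s0); apply/zero_modP => v; apply: subvs_inj.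
by have := subvsP (v : subvs_of _); rewrite memv0 => /eqP.
Qed.

Lemma factors_through0 X Y : factors_through C (0 : hom X Y).
Proof.
have [Z Z0] := zero_mod_exists X.
exists Z, 0, 0; split; first exact: add_closure_0.
by apply: hom_ext => x; rewrite /= comp_lfunE !zero_lfunE.
Qed.

Lemma factors_through_lin X Y (c : k) (h h' : hom X Y) :
  factors_through C h -> factors_through C h' -> factors_through C (c *: h + h').
Proof.
move=> [P [g [f [CP ->]]]] [P' [g' [f' [CP' ->]]]].
have [g'' [f'' E]] := factors_sum (c *: g) f g' f'.
exists (dsum P P'), g'', f''; split; first exact: add_closure_dsum.
rewrite -E; congr (_ + _); apply: hom_ext => x.
by rewrite /= scale_lfunE !comp_lfunE scale_lfunE.
Qed.

Lemma factors_throughD X Y (h h' : hom X Y) :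
  factors_through C h -> factors_through C h' -> factors_through C (h + h').
Proof. by move=> Ch Ch'; rewrite -[h]scale1r; apply: factors_through_lin. Qed.

Lemma hom_compDr X Y Z (g : hom Y Z) (h h' : hom X Y) :
  hom_comp g (h + h') = hom_comp g h + hom_comp g h'.
Proof. by apply: hom_ext => v; rewrite /= !add_lfunE !comp_lfunE add_lfunE lfD. Qed.

Lemma factors_through_compl X Y Z (g : hom Y Z) (h : hom X Y) :
  factors_through C h -> factors_through C (hom_comp g h).
Proof.
by move=> [P [g' [f' [CP ->]]]]; exists P, (hom_comp g g'), f'; rewrite hom_compA.
Qed.

Lemma factors_through_compr X Y Z (g : hom Y Z) (h : hom X Y) :
  factors_through C g -> factors_through C (hom_comp g h).
Proof.
by move=> [P [g' [f' [CP ->]]]]; exists P, g', (hom_comp f' h); rewrite hom_compA.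
Qed.

(** The factoring maps form a subspace of the finite-dimensional space [hom X Y]. The direct sum of
    the modules through which the members of a basis factor serves for all linear combinations. *)
Lemma factors_through_uniform X Y : exists2 P, add_closure C P &
  forall h : hom X Y, factors_through C h ->
    exists (g : hom P Y) (f : hom X P), h = hom_comp g f.
Proof.
have [K KP] := @vspace_of_pred k (hom X Y) (fun h => factors_through C h)
  (factors_through0 X Y) (@factors_through_lin X Y).
have H (s : seq (hom X Y)) : (forall h, h \in s -> factors_through C h) ->
    exists2 P, add_closure C P & forall h : hom X Y, h \in <<s>>%VS ->
    exists (g : hom P Y) (f : hom X P), h = hom_comp g f.
  elim: s => [_|h s IH sC].
    have [Z Z0] := zero_mod_exists X.
    exists Z => [|h]; first exact: add_closure_0.
    rewrite span_nil memv0 => /eqP ->; exists 0, 0.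
    by apply: hom_ext => x; rewrite /= comp_lfunE !zero_lfunE.
  have [h' h's|P CP sP] := IH; first by apply: sC; rewrite inE h's orbT.
  have [P' [g [f [CP' hE]]]] := sC h (mem_head _ _).
  exists (dsum P' P); first exact: add_closure_dsum.
  move=> x; rewrite span_cons => /memv_addP [_ /vlineP [c ->] [y /sP [g' [f' ->]] ->]].
  have [g'' [f'' E]] := factors_sum (c *: g) f g' f'.
  exists g'', f''; rewrite -E; congr (_ + _); apply: hom_ext => v.
  by rewrite hE /= scale_lfunE !comp_lfunE scale_lfunE.
have [h /vbasis_mem /KP //|P CP hP] := H (vbasis K).
by exists P => // h /KP hK; apply: hP; rewrite (span_basis (vbasisP K)).
Qed.

End FactorsThrough.

Lemma act_hom_modE (k : fieldType) (A : fdalg k) (D Y : fdmod A) (b : hom D D)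
    (h : hom D Y) :
  mod_act (hom_mod D Y) b h = hom_comp h b.
Proof. exact: hom_mod_actE. Qed.

Section Realization.
Variables (k : fieldType) (L : fdalg k) (wild : controlled_wild L).

(* [D = F(G) + C'] and [Y = F(M)], where [C'] is an object of [add C] through which
   all the maps in [Hom(F(G), C, F(M))] factor, and [eps] is the projection onto [C']. *)
Theorem controlled_wild_realization (G : fdalg k) (M : fdmod G) :
  exists (D Y : fdmod L) (gam : 'Hom(endop D, G)) (q : 'Hom(hom_mod D Y, M))
    (eps : endop D),
  [/\ gam (alg_one (endop D)) = alg_one G,
      forall b c, gam (alg_mul b c) = alg_mul (gam b) (gam c) &
      forall x, exists2 b, gam b = x & alg_mul x x = x -> alg_mul b b = b] /\
  [/\ forall b h, q (mod_act (hom_mod D Y) b h) = mod_act M (gam b) (q h),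
      forall m, exists h, q h = m,
      alg_mul eps eps = eps, gam eps = 0 &
      forall U : {vspace hom_mod D Y}, submodule U ->
        (forall h, mod_act (hom_mod D Y) eps h \in U) -> (lker q <= U)%VS].
Proof.
have [F [C [_ Ffaith FC]]] := wild G.
pose R := regular_mod G; pose T := F R.
have [C' addC' C'P] := factors_through_uniform C T (F M).
have [i [i' [p [p' [pi1 pi1' pi0 pi0' dec]]]]] := dsum_biproduct T C'.
pose D := dsum T C'; rewrite -/D in i i' p p' pi1 pi1' pi0 pi0' dec.
have piE w : vsval p (vsval i w) = w.
  move/(congr1 (fun g : hom T T => vsval g w)): pi1.
  by rewrite /= comp_lfunE id_lfunE.
have pi'E w : vsval p' (vsval i' w) = w.
  move/(congr1 (fun g : hom C' C' => vsval g w)): pi1'.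
  by rewrite /= comp_lfunE id_lfunE.
(* The restriction of [h] to [T] is F f modulo maps through [C], and [f], being defined on the
   regular module, is known by its value at 1. *)
pose rel X (h : hom D (F X)) (m : X) := exists (f : hom R X) (c : hom T (F X)),
  [/\ factors_through C c, hom_comp h i = fun_mor F R X f + c & m = vsval f (alg_one G)].
have qex X : exists q : 'Hom(hom D (F X), X), forall h m, rel X h m <-> m = q h.
  apply: linfun_of_rel.
  - move=> h; have [_ /(_ (hom_comp h i)) [f [c [Cc E]]] _] := FC R X.
    by exists (vsval f (alg_one G)), f, c.
  (* For [h] = 0, F f = -c factors through [C], so F f = 0 because the sum is direct, and f = 0
     because [F] is faithful. *)
  - move=> m [f [c [Cc E ->]]]; have [_ _ /(_ f)] := FC R X.
    have Fc : fun_mor F R X f = (-1) *: c + 0.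
      rewrite addr0 scaleN1r; apply/eqP; rewrite -addr_eq0 -E; apply/eqP.
      by apply: hom_ext => v; rewrite /= comp_lfunE !zero_lfunE.
    have CFf : factors_through C (fun_mor F R X f).
      by rewrite Fc; apply: factors_through_lin => //; apply: factors_through0.
    move=> /(_ CFf); have -> : 0 = fun_mor F R X 0 by rewrite linear0.
    by move/Ffaith => ->; rewrite zero_lfunE.
  - move=> a h m h' m' [f [c [Cc E ->]]] [f' [c' [Cc' E' ->]]].
    exists (a *: f + f'), (a *: c + c'); split.
    + exact: factors_through_lin.
    + rewrite hom_comp_linl E E' linearP scalerDr /= addrACA; exact.
    + by rewrite /= add_lfunE scale_lfunE.
pose q X := proj1_sig (constructive_indefinite_description _ (qex X)).
have qP X h m : rel X h m <-> m = q X h.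
  by rewrite /q; case: constructive_indefinite_description => q' /= ->.
(* Modulo maps through [C], the component T -> T of [b] is [F] of right multiplication by [gam b].
   Multiplicativity will be the case X = R of [qM]. *)
pose gam : 'Hom(endop D, G) := linfun (fun b : hom D D => q R (hom_comp p b)).
have gamE b : gam b = q R (hom_comp p b).
  have fl : linear (fun b : hom D D => q R (hom_comp p b)).
    by move=> c u v; rewrite hom_comp_linr lfD lfZ.
  by rewrite linfun_apply.
have qM X (h : hom D (F X)) (b : hom D D) :
    q X (hom_comp h b) = mod_act X (gam b) (q X h).
  apply/esym/qP; rewrite gamE.
  have [f [c [Cc E ->]]] := proj2 (qP X h _) erefl.
  have [f' [c' [Cc' E' ->]]] := proj2 (qP R (hom_comp p b) _) erefl.
  pose FX := fun_mor F R X; pose FR := fun_mor F R R.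
  (* Inserting id = i p + i' p' after [b] gives h b i = F f (F f' + c') + c (p b i) + (h i') (p' b
     i), in which every term other than F (f f') factors through [C]. *)
  exists (hom_comp f f'), (hom_comp (FX f) c' + (hom_comp c (hom_comp (hom_comp p b) i)
    + hom_comp (hom_comp h i') (hom_comp (hom_comp p' b) i))); split.
  - apply: factors_throughD; first exact: factors_through_compl.
    apply: factors_throughD; first exact: factors_through_compr.
    by exists C', (hom_comp h i'), (hom_comp (hom_comp p' b) i).
  - rewrite fun_comp; apply: hom_ext => v.
    have decE w : w = vsval i (vsval p w) + vsval i' (vsval p' w).
      move/(congr1 (fun g : hom D D => vsval g w)): dec.
      by rewrite /= add_lfunE !comp_lfunE id_lfunE.
    have Ev w : vsval h (vsval i w) = vsval (FX f) w + vsval c w.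
      move/(congr1 (fun g : hom T (F X) => vsval g w)): E.
      by rewrite /= add_lfunE comp_lfunE.
    have E'v w : vsval p (vsval b (vsval i w)) = vsval (FR f') w + vsval c' w.
      move/(congr1 (fun g : hom T (F R) => vsval g w)): E'.
      by rewrite /= add_lfunE !comp_lfunE.
    rewrite /= !add_lfunE !comp_lfunE /= [in LHS](decE (vsval b (vsval i v))).
    by rewrite lfD Ev [in X in X + _ + _]E'v lfD !addrA.
  - by rewrite -hom_actE regular_actE /= comp_lfunE alg_mul1r.
have qM' X (h : hom D (F X)) (f : hom R X) : hom_comp h i = fun_mor F R X f ->
    q X h = vsval f (alg_one G).
  move=> E; apply/esym/qP; exists f, 0; split=> //; first exact: factors_through0.
  by rewrite addr0.
(* The lift of [x] is [F] of right multiplication by [x], extended by 0 on [C']; it is idempotent as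
   soon as [x] is. *)
have gam_r x : exists r : hom R R, (forall a : G, vsval r a = alg_mul a x) /\
    gam (hom_comp i (hom_comp (fun_mor F R R r) p)) = x.
  have [r rE] := @regular_hom _ G R x; exists r.
  have rE' (a : G) : vsval r a = alg_mul a x by rewrite rE regular_actE.
  split=> //; rewrite gamE (qM' R _ r).
    by rewrite rE' alg_mul1l.
  by rewrite !hom_compA pi1 hom_comp1l -hom_compA pi1 hom_comp1r.
pose eps : endop D := hom_comp i' p'.
exists D, (F M), gam, (q M), eps; split; split.
- rewrite gamE hom_comp1r (qM' R _ (hom_id R)) /= ?id_lfunE //.
  by rewrite pi1 fun_id.
- move=> b c; rewrite !gamE /= /endop_mul hom_compA.
  rewrite (qM R (hom_comp p c) b) gamE.
  exact: regular_actE.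
- move=> x; have [r [rE gx]] := gam_r x.
  exists (hom_comp i (hom_comp (fun_mor F R R r) p)) => // xx.
  have rr : hom_comp r r = r.
    by apply: hom_ext => a; rewrite /= comp_lfunE !rE -alg_mulA xx.
  have FrE w : vsval (fun_mor F R R r) (vsval (fun_mor F R R r) w) =
      vsval (fun_mor F R R r) w by rewrite -[in RHS]rr fun_comp /= comp_lfunE.
  by apply: hom_ext => w; rewrite /= !comp_lfunE piE FrE.
- by move=> b h; rewrite act_hom_modE qM.
- move=> m; have [f fE] := regular_hom m.
  exists (hom_comp (fun_mor F R M f) p); rewrite (qM' M _ f) ?fE ?act1E //.
  by rewrite -hom_compA pi1 hom_comp1r.
- by apply: hom_ext => w; rewrite /= !comp_lfunE pi'E.
- rewrite gamE (qM' R _ 0); first by rewrite zero_lfunE.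
  rewrite /eps hom_compA pi0; apply: hom_ext => v.
  by rewrite linear0 /= !comp_lfunE !zero_lfunE.
move=> U sU epsU; apply/subvP => h; rewrite memv_ker => /eqP qh0.
have [f [c [Cc E m0]]] := proj2 (qP M h 0) (esym qh0).
have f0 : f = 0.
  apply: hom_ext => a; rewrite zero_lfunE -[a]alg_mul1r.
  by rewrite -(regular_actE a) hom_actE -m0 linear0.
rewrite f0 linear0 add0r in E.
have [v [u cE]] := C'P c Cc.
(* Here h i = c = v u with [v] defined on [C']. Hence h = h i p + h i' p' is the sum of v u p, which
   is a multiple of v p' = eps (v p'), and of eps h. *)
have -> : h = mod_act (hom_mod D (F M)) (hom_comp i' (hom_comp u p) : endop D)
    (mod_act (hom_mod D (F M)) eps (hom_comp v p'))
    + mod_act (hom_mod D (F M)) eps h.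
  rewrite !act_hom_modE /eps -!hom_compA.
  rewrite (hom_compA p' i') pi1' hom_comp1l (hom_compA p' i') pi1' hom_comp1l.
  rewrite (hom_compA v) -cE -E -hom_compA.
  by rewrite -hom_compDr dec hom_comp1r.
by rewrite memvD // sU.
Qed.
End Realization.

(** * Equations of projective sets *)

(** Take a finite set that dominates in the first [n] coordinates and let [J] bound its coordinate
    [n]. Elements whose coordinate [n] is at least [J] are covered by it; the finitely many slices
    below [J] are covered by the induction hypothesis. The coordinates are functions on an arbitrary
    type, so that polynomials can be compared by their leading monomials. *)
Lemma dickson (T : Type) (c : nat -> T -> nat) (n : nat) (S : T -> Prop) :
  exists s : seq T, (forall g, List.In g s -> S g) /\
    forall f, S f -> exists2 g, List.In g s & forall i, (i < n)%N -> (c i g <= c i f)%N.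
Proof.
elim: n S => [|n IH] S.
  case: (classic (exists f, S f)) => [[f Sf]|noS]; last first.
    by exists [::]; split=> // f Sf; case: noS; exists f.
  exists [:: f]; split=> [g [<-|[]] //|g _]; exists f => //; by left.
have [s [sS sP]] := IH S.
have [J JP] : exists J, forall g, List.In g s -> (c n g <= J)%N.
  elim: s {sS sP} => [|g s [J JP]]; first by exists 0%N.
  exists (maxn (c n g) J) => h [<-|/JP hJ]; first exact: leq_maxl.
  by rewrite leq_max hJ orbT.
have [t [tS tP]] : exists t : seq T, (forall g, List.In g t -> S g) /\
    forall f, S f -> (c n f < J)%N -> exists2 g, List.In g t &
      forall i, (i < n.+1)%N -> (c i g <= c i f)%N.
  elim: J {JP} => [|J [t [tS tP]]]; first by exists [::].
  have [u [uS uP]] := IH (fun f => S f /\ c n f = J).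
  exists (u ++ t)%list; split=> [g /List.in_app_iff [/uS []|/tS] //|f Sf].
  rewrite ltnS leq_eqVlt => /orP [/eqP fJ|/(tP f Sf) [g gt gP]]; last first.
    by exists g => //; apply/List.in_app_iff; right.
  have [g gu gP] := uP f (conj Sf fJ).
  exists g; first by apply/List.in_app_iff; left.
  move=> i; rewrite ltnS leq_eqVlt => /orP [/eqP ->|/gP //].
  by rewrite fJ; have [_ ->] := uS g gu.
exists (s ++ t)%list; split=> [g /List.in_app_iff [/sS|/tS] //|f Sf].
case: (ltnP (c n f) J) => [/(tP f Sf) [g gt gP]|Jf].
  by exists g => //; apply/List.in_app_iff; right.
have [g gs gP] := sP f Sf; exists g; first by apply/List.in_app_iff; left.
move=> i; rewrite ltnS leq_eqVlt => /orP [/eqP ->|/gP //].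
exact: leq_trans (JP g gs) Jf.
Qed.

Section Noetherian.
Import Order.TTheory.
Variables (k : fieldType) (n : nat).

(* Hilbert's basis theorem for zero sets: the leading monomials of the polynomials
   that vanish on the zero set of a finite part of [F] are dominated by finitely many
   of them (Dickson), and division reduces everything to these. *)
Lemma finite_zero_set (F : {mpoly k[n]} -> Prop) :
  exists s : seq {mpoly k[n]}, (forall f, f \in s -> F f) /\
    forall x : 'I_n -> k, (forall f, f \in s -> f.@[x] = 0) ->
    forall f, F f -> f.@[x] = 0.
Proof.
(* This contains [F] and behaves like an ideal; each member needs its own finite part of [F], and
   the task is to make this part uniform. *)
pose I (p : {mpoly k[n]}) := exists s : seq {mpoly k[n]}, (forall f, f \in s -> F f) /\
    forall x : 'I_n -> k, (forall f, f \in s -> f.@[x] = 0) -> p.@[x] = 0.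
have IF f : F f -> I f.
  move=> Ff; exists [:: f]; split=> [g|x]; first by rewrite inE => /eqP ->.
  by apply; rewrite mem_head.
have Ilin (a g p : {mpoly k[n]}) : I g -> I p -> I (p - a * g).
  move=> [s [sF sP]] [t [tF tP]]; exists (s ++ t); split=> [f|x xP].
    by rewrite mem_cat => /orP [/sF|/tF].
  rewrite mevalB mevalM sP ?tP ?mulr0 ?subr0 // => f fs; apply: xP.
    by rewrite mem_cat fs orbT.
  by rewrite mem_cat fs.
pose c i (f : {mpoly k[n]}) : nat :=
  if insub i is Some j then mlead f (j : 'I_n) else 0%N.
have [s [sI sP]] := dickson c n (fun f => I f /\ f != 0).
have [t [tF tP]] : exists t : seq {mpoly k[n]}, (forall f, f \in t -> F f) /\
    forall x : 'I_n -> k, (forall f, f \in t -> f.@[x] = 0) ->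
    forall g, List.In g s -> g.@[x] = 0.
  elim: s sI {sP} => [_|g s IH sI]; first by exists [::].
  have [h hs|t [tF tP]] := IH; first by apply: sI; right.
  have [[u [uF uP]] _] := sI g (or_introl erefl).
  exists (u ++ t); split=> [f|x xP h].
    by rewrite mem_cat => /orP [/uF|/tF].
  have xu f : f \in u -> f.@[x] = 0 by move=> fu; apply: xP; rewrite mem_cat fu.
  case=> [<-|]; first exact: uP.
  by apply: tP => f ft; apply: xP; rewrite mem_cat ft orbT.
exists t; split=> // x /tP xs f /IF.
move: {2}(mlead f) (erefl (mlead f)) => m; elim/(@ltmwf n): m f => m IH f fm If.
have [->|f0] := eqVneq f 0; first by rewrite meval0.
have [g gs gf] := sP f (conj If f0).
have [Ig g0] := sI g gs.
have le_gf : (mlead g <= mlead f)%MM.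
  by apply/mnm_lepP => i; have := gf i (ltn_ord i); rewrite /c valK.
(* The quotient of the leading terms: f - a g stays in [I], and it is zero or has a smaller leading
   monomial. *)
pose a := (f@_(mlead f) / g@_(mlead g)) *: 'X_[mlead f - mlead g] : {mpoly k[n]}.
have lg0 : g@_(mlead g) != 0 by rewrite mleadc_eq0.
have lf0 : f@_(mlead f) != 0 by rewrite mleadc_eq0.
have a0 : f@_(mlead f) / g@_(mlead g) != 0 by rewrite mulf_neq0 ?invr_eq0.
have leada : mlead a = (mlead f - mlead g)%MM by rewrite mleadZ // mleadXm.
have E : (f - a * g)@_(mlead f) = 0.
  rewrite mcoeffB -{2}(submK le_gf) -leada mleadcM mleadcZE.
  by rewrite mleadXm mcoeffX eqxx mulr1 divfK // subrr.
have : (f - a * g).@[x] = 0.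
  have [->|r0] := eqVneq (f - a * g) 0; first by rewrite meval0.
  apply: (IH (mlead (f - a * g))) => //; last exact: Ilin.
  have lea : (mlead (f - a * g) <= mlead f)%O.
    apply: le_trans (mleadB_le _ _) _; rewrite leUx lexx /=.
    by apply: le_trans (mleadM_le _ _) _; rewrite leada submK.
  rewrite -fm lt_neqAle lea andbT; apply/eqP => e.
  by move: E; rewrite -e => /eqP; rewrite mleadc_eq0 (negPf r0).
by rewrite mevalB mevalM (xs g gs) mulr0 subr0.
Qed.

Lemma meval_homog d (f : {mpoly k[n]}) (a : k) (x : 'rV[k]_n) :
  f \is d.-homog -> f.@[(a *: x) 0] = a ^+ d * f.@[x 0].
Proof.
move=> /dhomogP fd; rewrite !mevalE mulr_sumr; apply: eq_big_seq => m mf.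
rewrite mulrCA; congr (_ * _).
transitivity (\prod_(i < n) (a ^+ m i * x 0 i ^+ m i)).
  by apply: eq_bigr => i _; rewrite mxE exprMn.
by rewrite big_split /= prodrXr -mdegE fd.
Qed.

(** The bound is the largest degree in a finite part of [F] with the same zeros; it starts from 1,
    since contraction by monomials of degree d - 1 requires d > 0. *)
Lemma zariski_closed_bounded_degree (V : proj_set k n) : zariski_closed V ->
  exists (F : {mpoly k[n]} -> Prop) (d : nat), (0 < d)%N /\
    forall x : 'rV[k]_n, x != 0 -> V <[x]>%VS <->
      forall f e, F f -> f \is e.-homog -> (e <= d)%N -> f.@[x 0] = 0.
Proof.
case=> F [Fhom FV]; have [s [sF sP]] := finite_zero_set F.
have [d d0 dP] : exists2 d, (0 < d)%N &
    forall f, f \in s -> exists2 e, f \is e.-homog & (e <= d)%N.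
  elim: s sF {sP} => [|f s IH] sF; first by exists 1%N.
  have [g gs|d d0 dP] := IH; first by apply: sF; rewrite inE gs orbT.
  have [e fe] := Fhom f (sF f (mem_head _ _)).
  exists (maxn e d) => [|g]; first by rewrite leq_max d0 orbT.
  rewrite inE => /orP [/eqP ->|/dP [e' ge' le']]; first by exists e; rewrite ?leq_maxl.
  by exists e'; rewrite // leq_max le' orbT.
exists F, d; split=> // x x0; split=> [/FV [_ Vx] f e Ff _ _|xP].
  by apply: Vx (memv_line x).
apply/FV; rewrite dim_vline x0; split=> // f Ff _ /vlineP [a ->].
have [e fe] := Fhom f Ff; rewrite (meval_homog _ _ fe).
rewrite (sP (x 0)) ?mulr0 // => g gs; have [e' ge' le'] := dP g gs.
exact: xP (sF g gs) ge' le'.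
Qed.

End Noetherian.

(** * Generalized Kronecker representations *)

Section TriangularAlgebra.
Variables (k : fieldType) (W : vectType k).

(* [(a, b, w)] is the lower triangular matrix with diagonal [a, b] and entry [w]. *)
Definition tri_car : vectType k := (k^o * k^o * W)%type.
Definition tri_one : tri_car := (1, 1, 0).
Definition tri_mul (x y : tri_car) : tri_car :=
  (x.1.1 * y.1.1, x.1.2 * y.1.2, (x.1.2 : k) *: y.2 + (y.1.1 : k) *: x.2).

Lemma tri_eq (x y : tri_car) : x.1.1 = y.1.1 -> x.1.2 = y.1.2 -> x.2 = y.2 -> x = y.
Proof. by case: x y => [[a b] w] [[a' b'] w'] /= -> -> ->. Qed.

Lemma tri_mulA : associative tri_mul.
Proof.
move=> x y z; apply: tri_eq => /=; rewrite ?mulrA //.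
by rewrite !scalerDr !scalerA addrA [z.1.1 * x.1.2]mulrC [z.1.1 * y.1.1]mulrC.
Qed.

Lemma tri_mul1l : left_id tri_one tri_mul.
Proof. by move=> x; apply: tri_eq; rewrite /= ?mul1r // scale1r scaler0 addr0. Qed.

Lemma tri_mul1r : right_id tri_one tri_mul.
Proof. by move=> x; apply: tri_eq; rewrite /= ?mulr1 // scale1r scaler0 add0r. Qed.

Lemma tri_mul_linl y : linear (tri_mul^~ y).
Proof.
move=> c u v; apply: tri_eq => /=; rewrite ?mulrDl -?scalerAl //.
by rewrite scalerDl !scalerDr !scalerA addrACA [_ * c]mulrC.
Qed.

Lemma tri_mul_linr x : linear (tri_mul x).
Proof.
move=> c u v; apply: tri_eq => /=; rewrite ?mulrDr -?scalerAr //.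
by rewrite scalerDl !scalerDr !scalerA addrACA [_ * c]mulrC.
Qed.

Definition tri_alg : fdalg k := FdAlg tri_mulA tri_mul1l tri_mul1r tri_mul_linl tri_mul_linr.

Variables (T0 T1 : vectType k) (beta : {linear W -> 'Hom(T0, T1)}).

(** Lower triangular matrices act on columns: the diagonal idempotents project to the two vertices,
    and [W] is the space of arrows from [T0] to [T1]. *)
Definition tri_act (x : tri_alg) : 'End((T0 * T1)%type : vectType k) :=
  linfun (fun v : T0 * T1 =>
    ((x.1.1 : k) *: v.1, (x.1.2 : k) *: v.2 + beta x.2 v.1)).

Lemma tri_act_apply (x : tri_alg) (v : T0 * T1) :
  tri_act x v = ((x.1.1 : k) *: v.1, (x.1.2 : k) *: v.2 + beta x.2 v.1).
Proof.
rewrite /tri_act linfun_apply // => c u u'.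
apply: (congr2 pair); rewrite /= scalerDr !scalerA [_ * c]mulrC //.
by rewrite lfD lfZ scalerDr scalerA addrACA.
Qed.

Lemma tri_act_is_linear : linear tri_act.
Proof.
move=> c x y; apply/lfunP => v; rewrite add_lfunE scale_lfunE !tri_act_apply.
apply: (congr2 pair); rewrite /= scalerDl ?scalerDr !scalerA //.
by rewrite linearP add_lfunE scale_lfunE addrACA.
Qed.
HB.instance Definition _ :=
  GRing.isLinear.Build k tri_alg 'End((T0 * T1)%type : vectType k) _ tri_act
    tri_act_is_linear.

Lemma tri_act1 : tri_act (alg_one tri_alg) = \1%VF.
Proof.
apply/lfunP => -[t y]; rewrite tri_act_apply id_lfunE /=.
by rewrite !scale1r linear0 zero_lfunE addr0.
Qed.

Lemma tri_actM x y : tri_act (alg_mul x y) = (tri_act x \o tri_act y)%VF.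
Proof.
apply/lfunP => v; rewrite comp_lfunE !tri_act_apply /=.
apply: (congr2 pair); rewrite /= ?scalerA //.
rewrite linearD !linearZ /= add_lfunE !scale_lfunE scalerDr scalerA.
by rewrite addrA.
Qed.

Definition tri_mod : fdmod tri_alg :=
  @FdMod k tri_alg (T0 * T1)%type tri_act tri_act1 tri_actM.

Lemma tri_actE (x : tri_alg) (v : tri_mod) :
  mod_act tri_mod x v = ((x.1.1 : k) *: v.1, (x.1.2 : k) *: v.2 + beta x.2 v.1).
Proof. exact: tri_act_apply. Qed.

End TriangularAlgebra.

Lemma act_rank_submod (k : fieldType) (A : fdalg k) (M : fdmod A) (U : {vspace M})
    (sU : submodule U) (b : A) :
  act_rank b (submod sU) = \dim (mod_act M b @: U)%VS.
Proof.
have [f fE] := submod_incl_full sU; rewrite /act_rank.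
rewrite -(@limg_dim_eq _ _ _ (vsval f) (limg _)); last first.
  have /lker0P/eqP -> : injective (vsval f) by move=> u v; rewrite !fE => /subvs_inj.
  by rewrite capv0.
congr (\dim _); apply/vspaceP => x; apply/memv_imgP/memv_imgP.
  case=> _ /memv_imgP [u _ ->] ->; exists (vsval (u : subvs_of U)).
    exact: subvsP.
  by rewrite hom_actE fE.
case=> u uU ->; exists (mod_act (submod sU) b (Subvs uU : subvs_of U)).
  by rewrite memv_img ?memvf.
by rewrite hom_actE fE.
Qed.

(** * From dimension vectors to subrepresentations of dimension vector (1, 1) *)

Section TriangularRealization.
Variables (k : fieldType) (T0 T1 W : vectType k) (beta : {linear W -> 'Hom(T0, T1)}).
Notation G := (tri_alg W).

(* Submodules of [H] whose dimension vector exceeds that of [lker q] by one at each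
   vertex of the triangular algebra. *)
Lemma dimvec_tri (B : fdalg k) (H : fdmod B) (gam : 'Hom(B, G))
    (q : 'Hom(H, (T0 * T1)%type : vectType k)) (eps : B) :
  gam (alg_one B) = alg_one G ->
  (forall b c, gam (alg_mul b c) = alg_mul (gam b) (gam c)) ->
  (forall x, exists2 b, gam b = x & alg_mul x x = x -> alg_mul b b = b) ->
  (forall b h, q (mod_act H b h) = mod_act (tri_mod beta) (gam b) (q h)) ->
  alg_mul eps eps = eps -> gam eps = 0 ->
  (forall U, submodule U -> (forall h, mod_act H eps h \in U) -> (lker q <= U)%VS) ->
  (forall y, (0, y) \in limg q) ->
  exists2 e : dimvec B, total_dim e (1 + (1 + \dim (lker q)))%N &
    forall U : {vspace H},
      (exists sU : submodule U, has_dimvec (submod sU) e) <->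
      exists (t : T0) (y : T1), [/\ t != 0, y != 0, (t, 0) \in limg q,
        forall w, beta w t \in <[y]>%VS &
        U = (q @^-1: (<[(t, 0%R)]> + <[(0%R, y)]>))%VS].
Proof.
move=> gam1 gamM gamS qM epsI geps epsU qy.
have memP (t t' : T0) (y y' : T1) : (t', y') \in (<[(t, 0%R)]> + <[(0%R, y)]>)%VS <->
    t' \in <[t]>%VS /\ y' \in <[y]>%VS.
  split=> [/memv_addP [_ /vlineP [a ->] [_ /vlineP [b ->]]] [-> ->]|].
    by rewrite !scaler0 addr0 add0r !memvZ ?memv_line.
  case=> /vlineP [a ->] /vlineP [b ->].
  have -> : (a *: t, b *: y) = a *: (t, 0 : T1) + b *: (0 : T0, y).
    by apply: (congr2 pair); rewrite /= scaler0 ?addr0 ?add0r.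
  by apply: memv_add; rewrite memvZ ?memv_line.
have qM' b h : q (mod_act H b h) = (((gam b).1.1 : k) *: (q h).1,
    ((gam b).1.2 : k) *: (q h).2 + beta (gam b).2 (q h).1).
  by rewrite qM tri_actE.
(* The diagonal entries of a triangular matrix are multiplicative, so through [gam] they give two
   characters of [B], one for each vertex. *)
pose c0 : 'Hom(B, k^o) := linfun (fun b => (gam b).1.1).
pose c1 : 'Hom(B, k^o) := linfun (fun b => (gam b).1.2).
have c0E b : c0 b = (gam b).1.1.
  by rewrite /c0 linfun_apply // => a u v; rewrite lfD lfZ.
have c1E b : c1 b = (gam b).1.2.
  by rewrite /c1 linfun_apply // => a u v; rewrite lfD lfZ.
have c01 : c0 (alg_one B) = 1 by rewrite c0E gam1.
have c11 : c1 (alg_one B) = 1 by rewrite c1E gam1.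
have c0M a b : c0 (alg_mul a b) = c0 a * c0 b by rewrite !c0E gamM.
have c1M a b : c1 (alg_mul a b) = c1 a * c1 b by rewrite !c1E gamM.
pose S0 := char_simple c01 c0M; pose S1 := char_simple c11 c1M.
have sW : submodule (lker q).
  move=> b h; rewrite !memv_ker qM => /eqP ->; by rewrite linear0.
have [l0 l0P] := comp_series_exists (submod sW).
have dl0 : (\sum_(T <- l0) \dim {:T})%N = \dim (lker q).
  by rewrite -(comp_series_dim l0P) dimvf.
exists (dimvec_of [:: S0, S1 & l0]).
  have := total_dim_of [:: S0, S1 & l0].
  by rewrite !big_cons dl0 /= !dimvf.
move=> U; split; last first.
  case=> t [y [t0 y0 /memv_imgP [h0 _ qh0] tw UE]].
  have /memv_imgP [h1 _ qh1] := qy y.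
  have sU : submodule U.
    move=> b u; rewrite UE -!memv_preim qM'; case: (q u) => t' y' /memP [t't y'y].
    apply/memP => /=; split; first exact: memvZ.
    by have /vlineP [a ->] := t't; rewrite lfZ memvD ?memvZ.
  exists sU; apply: has_dimvec_of.
  (* The chain from [lker q] through [U1] to [U] has the factors [S1] and [S0], in this order from
     below. *)
  pose U1 := (q @^-1: <[(0%R : T0, y)]>)%VS.
  have U1P h : h \in U1 <-> (q h).1 = 0 /\ (q h).2 \in <[y]>%VS.
    rewrite -memv_preim; have := memP 0 (q h).1 y (q h).2.
    have -> : <[(0%R : T0, 0%R : T1)]>%VS = 0%VS by [].
    rewrite add0v -surjective_pairing => ->; rewrite memv0.
    by split=> -[/eqP ? ?]; split=> //; apply/eqP.
  have sU1 : submodule U1.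
    move=> b u /U1P [u0 uy]; apply/U1P; rewrite qM' /= u0 scaler0 linear0 addr0.
    by rewrite memvZ.
  have [f1 [g1 fg1]] : exists (f : hom (submod sW) (submod sU1))
      (g : hom (submod sU1) S1), short_exact f g.
    apply: (@char_extension _ _ _ c11 c1M _ _ _ sW sU1 h1).
    - by rewrite -lpreim0; apply/lpreimS/sub0v.
    - by rewrite -memv_preim -qh1 memv_line.
    - by rewrite memv_ker -qh1; apply/eqP => -[/eqP]; rewrite (negPf y0).
    - apply/subvP => h /U1P [hq0 /vlineP [a ha]].
      rewrite -[h](subrK (a *: h1)); apply: memv_add; last by rewrite memvZ ?memv_line.
      rewrite memv_ker lfB lfZ -qh1 [q h]surjective_pairing hq0 ha.
      by apply/eqP; apply: (congr2 pair); rewrite /= ?scaler0 subrr.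
    - move=> b; rewrite memv_ker lfB lfZ /= c1E qM' -qh1 /= [beta _ 0]linear0 addr0 scaler0.
      by apply/eqP; apply: (congr2 pair); rewrite /= ?scaler0 subrr.
  have [f0 [g0 fg0]] : exists (f : hom (submod sU1) (submod sU))
      (g : hom (submod sU) S0), short_exact f g.
    apply: (@char_extension _ _ _ c01 c0M _ _ _ sU1 sU h0).
    - by rewrite UE; apply/lpreimS/addvSr.
    - by rewrite UE -memv_preim -qh0 (subvP (addvSl _ _)) ?memv_line.
    - by apply/negP => /U1P; rewrite -qh0 /= => -[/eqP]; rewrite (negPf t0).
    - rewrite UE; apply/subvP => h; rewrite -memv_preim.
      rewrite [q h]surjective_pairing => /memP [/vlineP [a ha] hy].
      rewrite -[h](subrK (a *: h0)); apply: memv_add; last by rewrite memvZ ?memv_line.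
      apply/U1P; rewrite lfB lfZ -qh0 /= ha subrr scaler0 subr0; by split.
    - move=> b; apply/U1P; rewrite lfB lfZ /= c0E qM' -qh0 /= subrr !scaler0 subr0 add0r.
      by split.
  by exists (submod sU1), f0, g0; split=> //; exists (submod sW), f1, g1.
case=> sU eU.
have rank b : alg_mul b b = b -> \dim (mod_act H b @: U)%VS =
    ((c0 b != 0%R) + ((c1 b != 0%R) + \dim (mod_act H b @: lker q)))%N.
  move=> bb; rewrite -(act_rank_submod sU) (has_dimvec_act_rank bb eU).
  rewrite !big_cons !act_rank_char -(act_rank_submod sW).
  by rewrite (act_rank_comp_series bb l0P).
have epsker h : mod_act H eps h \in lker q.
  by rewrite memv_ker qM geps linear0 zero_lfunE.
have actU b : (mod_act H b @: U <= U)%VS.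
  apply/subvP => _ /memv_imgP [u uU ->]; exact: (sU).
(* Both characters vanish at [eps], so eps U has the dimension of eps (lker q). The latter contains
   eps H, because [eps] is idempotent and maps [H] into [lker q]. Thus eps U = eps H and [epsU]
   applies. *)
have kerU : (lker q <= U)%VS.
  apply: epsU => // h; apply: (subvP (actU eps)).
  have eHU : (mod_act H eps @: U <= mod_act H eps @: fullv)%VS by apply/limgS/subvf.
  suff /eqP -> : (mod_act H eps @: U)%VS == (mod_act H eps @: fullv)%VS.
    by rewrite memv_img ?memvf.
  rewrite eqEdim eHU rank // c0E c1E geps !eqxx /=.
  apply: dimvS; apply/subvP => _ /memv_imgP [u _ ->].
  by rewrite -{1}epsI actME memv_img.
have qrank b : alg_mul b b = b ->
    \dim (q @: (mod_act H b @: U))%VS = ((c0 b != 0%R) + (c1 b != 0%R))%N.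
  move=> bb; have := limg_ker_dim q (mod_act H b @: U); rewrite rank //.
  have -> : (mod_act H b @: U :&: lker q)%VS = (mod_act H b @: lker q)%VS.
    apply/vspaceP => x; rewrite memv_cap; apply/andP/idP.
      case=> /memv_imgP [u uU ->] xk; apply/memv_imgP; exists (mod_act H b u) => //.
      by rewrite -actME bb.
    case/memv_imgP => u uk ->; split; last exact: (sW).
    by rewrite memv_img // (subvP kerU).
  by move=> E; apply: (@addnI (\dim (mod_act H b @: lker q))); rewrite E addnA addnC.
have line (E : vectType k) (X : {vspace E}) : \dim X = 1%N -> exists2 v, v != 0 & X = <[v]>%VS.
  move=> dX; exists (vpick X); first by rewrite vpick0 -dimv_eq0 dX.
  by apply/eqP; rewrite eq_sym eqEdim -memvE memv_pick dim_vline vpick0 -dimv_eq0 dX.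
(* Idempotent lifts of the two diagonal idempotents; by [qrank] each of them cuts out a line in q U,
   and these lines provide [t] and [y]. *)
have [b0 gb0 b0I] := gamS ((1, 0, 0) : G).
have [b1 gb1 b1I] := gamS ((0, 1, 0) : G).
have {}b0I : alg_mul b0 b0 = b0.
  by apply: b0I; apply: tri_eq; rewrite /= ?mulr1 ?mulr0 ?scaler0 ?addr0.
have {}b1I : alg_mul b1 b1 = b1.
  by apply: b1I; apply: tri_eq; rewrite /= ?mulr1 ?mulr0 ?scaler0 ?addr0.
have qb0 h : q (mod_act H b0 h) = ((q h).1, 0).
  by rewrite qM' gb0 /= scale1r scale0r linear0 zero_lfunE addr0.
have qb1 h : q (mod_act H b1 h) = (0, (q h).2).
  by rewrite qM' gb1 /= scale1r scale0r linear0 zero_lfunE addr0.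
have [] := line _ (q @: (mod_act H b0 @: U))%VS.
  by rewrite qrank // c0E c1E gb0 /= oner_eq0 eqxx.
move=> [t y'] v0 tE.
have [] := line _ (q @: (mod_act H b1 @: U))%VS.
  by rewrite qrank // c0E c1E gb1 /= oner_eq0 eqxx.
move=> [t' y] v1 yE.
have y'0 : y' = 0.
  have : (t, y') \in <[(t, y')]>%VS by rewrite memv_line.
  by rewrite -tE => /memv_imgP [_ /memv_imgP [u _ ->]]; rewrite qb0 => -[].
have t'0 : t' = 0.
  have : (t', y) \in <[(t', y)]>%VS by rewrite memv_line.
  by rewrite -yE => /memv_imgP [_ /memv_imgP [u _ ->]]; rewrite qb1 => -[].
subst y' t'.
have [u0 u0U qu0] : exists2 u, u \in U & q u = (t, 0).
  have : (t, 0) \in <[(t, 0%R : T1)]>%VS by rewrite memv_line.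
  rewrite -tE => /memv_imgP [u uU ->]; exists u => //; exact: (subvP (actU b0)).
have [u1 u1U qu1] : exists2 u, u \in U & q u = (0, y).
  have : (0, y) \in <[(0%R : T0, y)]>%VS by rewrite memv_line.
  rewrite -yE => /memv_imgP [u uU ->]; exists u => //; exact: (subvP (actU b1)).
have q2 u : u \in U -> (q u).2 \in <[y]>%VS.
  move=> uU; have : (0, (q u).2) \in <[(0%R : T0, y)]>%VS.
    by rewrite -yE -qb1 !memv_img.
  by case/vlineP => a [_ ->]; rewrite memvZ ?memv_line.
have q1 u : u \in U -> (q u).1 \in <[t]>%VS.
  move=> uU; have : ((q u).1, 0) \in <[(t, 0%R : T1)]>%VS.
    by rewrite -tE -qb0 !memv_img.
  by case/vlineP => a [-> _]; rewrite memvZ ?memv_line.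
exists t, y; split.
- by apply: contraNneq v0 => ->.
- by apply: contraNneq v1 => ->.
- by rewrite -qu0 memv_img ?memvf.
- move=> w; have [b gb _] := gamS ((0, 0, w) : G).
  have := q2 _ (sU b _ u0U); by rewrite qM' gb qu0 /= scale0r add0r.
apply/vspaceP => u; rewrite -memv_preim; apply/idP/idP => [uU|].
  by rewrite [q u]surjective_pairing; apply/memP; split; [apply: q1|apply: q2].
rewrite [q u]surjective_pairing => /memP [/vlineP [a ua] /vlineP [c uc]].
rewrite -[u](subrK (a *: u0 + c *: u1)); apply: memvD; last by rewrite memvD ?memvZ.
apply: (subvP kerU); rewrite memv_ker lfB lfD !lfZ qu0 qu1 [q u]surjective_pairing ua uc.
by apply/eqP; apply: (congr2 pair); rewrite /= scaler0 ?addr0 ?add0r subrr.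
Qed.

(** The pairs with first entry in [K0] form a submodule because all of [T1] is kept. The realization
    theorem is applied to it, and the inclusion brings [q] back to [T0 * T1]. *)
Lemma tri_realization (L : fdalg k) (K0 : {vspace T0}) : controlled_wild L ->
  exists (D Y : fdmod L) (q : 'Hom(hom D Y, (T0 * T1)%type : vectType k))
    (e : dimvec (endop D)),
  [/\ total_dim e (1 + (1 + \dim (lker q)))%N,
    forall v, v \in limg q <-> v.1 \in K0 &
    forall U : {vspace hom_mod D Y},
      (exists sU : submodule U, has_dimvec (submod sU) e) <->
      exists (t : T0) (y : T1), [/\ t != 0, y != 0, t \in K0,
        forall w, beta w t \in <[y]>%VS &
        U = (q @^-1: (<[(t, 0%R)]> + <[(0%R, y)]>))%VS]].
Proof.
move=> wild.
have [K KP] : exists K : {vspace tri_mod beta}, forall v, v \in K <-> v.1 \in K0.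
  apply: vspace_of_pred => [|c u v uK vK]; first exact: mem0v.
  by rewrite /= memvD ?memvZ.
have sK : submodule K.
  by move=> x v /KP vK; apply/KP; rewrite tri_actE /= memvZ.
have [D [Y [gam [q [eps [[gam1 gamM gamS] [qM qS epsI geps epsU]]]]]]] :=
  controlled_wild_realization wild (submod sK).
have [iota iotaE] := submod_incl_full sK.
pose q' : 'Hom(hom_mod D Y, (T0 * T1)%type : vectType k) := (vsval iota \o q)%VF.
have q'E h : q' h = vsval (q h : subvs_of K) by rewrite /q' comp_lfunE iotaE.
have kerq : lker q' = lker q.
  apply/vspaceP => h; rewrite !memv_ker q'E; apply/eqP/eqP => [E|->] //.
  exact: subvs_inj.
have imq v : v \in limg q' <-> v.1 \in K0.
  split=> [/memv_imgP [h _ ->]|/KP vK].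
    by apply/KP; rewrite q'E subvsP.
  have [h hv] := qS (Subvs vK : subvs_of K).
  by apply/memv_imgP; exists h; rewrite ?memvf // q'E hv.
have [|||e eT eU] := @dimvec_tri _ (hom_mod D Y) gam q' eps gam1 gamM gamS _ epsI geps.
- move=> b h; rewrite !q'E qM; exact: (submod_actE sK).
- by move=> U sU UP; rewrite kerq; apply: epsU.
- by move=> y; apply/imq; rewrite /= mem0v.
exists D, Y, q', e; split=> // U; rewrite eU.
by split=> -[t [y [t0 y0 tK tw UE]]]; exists t, y; split=> //; [move/imq: tK | apply/imq].
Qed.

End TriangularRealization.

(** * Veronese tensors *)

Section Veronese.
Variables (k : fieldType) (n d : nat).
Implicit Types (x y : 'rV[k]_n) (m : 'X_{1..n}).

Definition mon x m : k := \prod_(i < n) x 0 i ^+ m i.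

Lemma monD x m m' : mon x (m + m') = mon x m * mon x m'.
Proof. by rewrite -big_split; apply: eq_bigr => i _; rewrite mnmDE exprD. Qed.

Lemma monU x i : mon x U_(i) = x 0 i.
Proof.
rewrite /mon (bigD1 i) //= mnm1E eqxx expr1 big1 ?mulr1 // => j ji.
by rewrite mnm1E eq_sym (negPf ji) expr0.
Qed.

Lemma monUn x i e : mon x (U_(i) *+ e)%MM = x 0 i ^+ e.
Proof.
rewrite /mon (bigD1 i) //= mulmnE mnm1E eqxx mul1n big1 ?mulr1 // => j ji.
by rewrite mulmnE mnm1E eq_sym (negPf ji) mul0n expr0.
Qed.

Lemma monZ a x m : mon (a *: x) m = a ^+ mdeg m * mon x m.
Proof.
rewrite /mon mdegE -prodrXr -big_split; apply: eq_bigr => i _.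
by rewrite mxE exprMn.
Qed.

(** Bounded multinomials form a finite type. Only the entries of degree [d] matter; those of smaller
    degree are set to zero in [veronese_space]. *)
Definition tensors : vectType k := {ffun 'X_{1..n < d.+1} -> k^o}.

Definition ext (t : tensors) m : k := if insub m is Some b then t b else 0.

Lemma ext_linear m : linear (fun t => ext t m : k^o).
Proof.
move=> a t t'; rewrite /ext; case: insubP => [b _ _|_]; first by rewrite !ffunE.
by rewrite scaler0 addr0.
Qed.

Lemma ext_val (t : tensors) (b : 'X_{1..n < d.+1}) : ext t b = t b.
Proof. by rewrite /ext valK. Qed.

Definition ver x : tensors := [ffun b : 'X_{1..n < d.+1} => if mdeg b == d then mon x b else 0].

Lemma ext_ver x m : mdeg m = d -> ext (ver x) m = mon x m.
Proof.
move=> md; rewrite /ext; case: insubP => [b _ bm|]; last by rewrite md ltnSn.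
by rewrite ffunE bm md eqxx.
Qed.

Lemma verZ a x : ver (a *: x) = a ^+ d *: ver x.
Proof.
apply/ffunP => b; rewrite !ffunE; case: eqP => [bd|_]; last by rewrite scaler0.
by rewrite monZ bd.
Qed.

Lemma mdeg_pure i : mdeg (U_(i) *+ d : 'X_{1..n})%MM = d.
Proof. by rewrite mdegMn mdeg1 mul1n. Qed.

Lemma pure_lt i : (mdeg (U_(i) *+ d : 'X_{1..n})%MM < d.+1)%N.
Proof. by rewrite mdeg_pure. Qed.

Definition pure_mon (i : 'I_n) : 'X_{1..n < d.+1} := BMultinom (pure_lt i).

Lemma ver_pure x i : ver x (pure_mon i) = x 0 i ^+ d.
Proof. by rewrite ffunE /= mdeg_pure eqxx monUn. Qed.

Lemma row_neq0 x : x != 0 -> exists i, x 0 i != 0.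
Proof.
move=> x0; apply: NNPP => H; case/eqP: x0; apply/rowP => i; rewrite mxE.
by apply/eqP/negPn/negP => xi; apply: H; exists i.
Qed.

Lemma ver_neq0 x : x != 0 -> ver x != 0.
Proof.
case/row_neq0 => i xi; apply: contraNneq (expf_neq0 d xi) => v0.
by rewrite -ver_pure v0 ffunE.
Qed.

Definition contraction_wt : vectType k := {ffun 'X_{1..n < d} -> k^o}.

(** For [w] concentrated at one monomial of degree d - 1 this is a row of the catalecticant matrix
    of [t]; on the Veronese image of [x] all these rows are multiples of [x]. *)
Definition contraction (w : contraction_wt) : 'Hom(tensors, 'rV[k]_n) :=
  linfun (fun t : tensors => \row_i \sum_(b : 'X_{1..n < d}) w b * ext t (b + U_(i))).

Lemma contractionE w t :
  contraction w t = \row_i \sum_(b : 'X_{1..n < d}) w b * ext t (b + U_(i)).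
Proof.
rewrite /contraction linfun_apply // => a u v; apply/rowP => i; rewrite !mxE.
rewrite mulr_sumr -big_split; apply: eq_bigr => b _ /=.
by rewrite ext_linear mulrDr; congr (_ + _); rewrite mulrCA.
Qed.

Lemma contraction_is_linear : linear contraction.
Proof.
move=> a w w'; apply/lfunP => t; rewrite add_lfunE scale_lfunE !contractionE.
apply/rowP => i; rewrite !mxE mulr_sumr -big_split; apply: eq_bigr => b _ /=.
by rewrite !ffunE mulrDl mulrA.
Qed.
HB.instance Definition _ :=
  GRing.isLinear.Build k contraction_wt 'Hom(tensors, 'rV[k]_n) _ contraction
    contraction_is_linear.

Lemma contraction_ver w x : contraction w (ver x) \in <[x]>%VS.
Proof.
apply/vlineP; exists (\sum_(b : 'X_{1..n < d} | (mdeg b).+1 == d) w b * mon x b).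
rewrite contractionE; apply/rowP => i; rewrite !mxE mulr_suml.
rewrite [LHS](bigID (fun b : 'X_{1..n < d} => (mdeg b).+1 == d)) /=.
(* Monomials of another degree than d - 1 meet only entries of [ver x] off degree [d], which are
   zero. *)
rewrite [X in _ + X]big1 ?addr0 => [|b bd].
  apply: eq_bigr => b /eqP bd; rewrite ext_ver ?monD ?monU ?mulrA //.
  by rewrite mdegD mdeg1 addn1.
rewrite /ext; case: insubP => [c _ cE|_]; last by rewrite mulr0.
by rewrite ffunE cE mdegD mdeg1 addn1 (negPf bd) mulr0.
Qed.

Hypothesis d_gt0 : (0 < d)%N.

(* Monomials of degree [d] are exchanged for the pure power of the variable [i]
   one variable at a time. *)
Lemma contraction_exchange (t : tensors) y i : y 0 i != 0 ->
  (forall w, contraction w t \in <[y]>%VS) ->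
  forall m, mdeg m = d -> ext t m * y 0 i ^+ d = ext t (U_(i) *+ d)%MM * mon y m.
Proof.
move=> yi tw.
(* The weight concentrated at [m] yields the row of the entries of [t] at m + U_(j). It is a
   multiple of [y], so its 2 x 2 minors with [y] vanish. *)
have exch m l : (mdeg m).+1 = d ->
    ext t (m + U_(l)) * y 0 i = ext t (m + U_(i)) * y 0 l.
  move=> md; have mlt : (mdeg m < d)%N by rewrite -md.
  have /vlineP [a E] := tw [ffun b => (b == BMultinom mlt)%:R].
  have extE j : ext t (m + U_(j)) = a * y 0 j.
    move/rowP/(_ j): E; rewrite contractionE !mxE => <-.
    rewrite (bigD1 (BMultinom mlt)) //= ffunE eqxx mul1r big1 ?addr0 // => b bm.
    by rewrite ffunE (negPf bm) mul0r.
  by rewrite !extE mulrAC.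
move=> m; move: {2}(d - m i)%N (leqnn (d - m i)) => s.
elim: s m => [|s IH] m ms md.
  have mi : m i = d.
    have : (m i <= d)%N by rewrite -md mdegE (bigD1 i) //= leq_addr.
    by move: ms; lia.
  suff -> : m = (U_(i) *+ d)%MM by rewrite monUn.
  apply/mnmP => j; rewrite mulmnE mnm1E; case: eqP => [<-|/eqP ij]; first by rewrite mi mul1n.
  move: md; rewrite mdegE (bigD1 i) //= mi (bigD1 j) 1?eq_sym //=; lia.
have [[j ji mj]|H] := classic (exists2 j, j != i & (0 < m j)%N).
  pose m' := (m - U_(j))%MM.
  have mE : m = (m' + U_(j))%MM.
    by rewrite submK //; apply/mnm_lepP => l; rewrite mnm1E; case: eqP => [<-|].
  have m'd : (mdeg m').+1 = d by rewrite -md mE mdegD mdeg1 addn1.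
  have m'i : m' i = m i by rewrite mE mnmDE mnm1E (negPf ji) addn0.
  apply: (mulIf yi); rewrite mulrAC mE exch // mulrAC IH.
  - by rewrite !monD !monU; ring.
  - by rewrite mnmDE mnm1E eqxx m'i; lia.
  - by rewrite mdegD mdeg1 addn1.
apply: IH => //; have : m i = d; last by lia.
rewrite -md mdegE (bigD1 i) //= big1 ?addn0 // => j ji.
by apply/eqP; rewrite -leqn0 leqNgt; apply/negP => mj; apply: H; exists j.
Qed.

Variables (V : proj_set k n) (F : {mpoly k[n]} -> Prop).
Hypothesis VP : forall x, x != 0 -> V <[x]>%VS <->
  forall f e, F f -> f \is e.-homog -> (e <= d)%N -> f.@[x 0] = 0.

(** Each equation is multiplied by all monomials of the complementary degree, and each monomial of
    the product is then read as a tensor entry. This makes the equations linear. *)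
Lemma veronese_space : exists K : {vspace tensors}, forall t, t \in K <->
  (forall b : 'X_{1..n < d.+1}, mdeg b != d -> t b = 0) /\
  forall f e m, F f -> f \is e.-homog -> (e + mdeg m = d)%N ->
    \sum_(m' <- msupp f) f@_m' * ext t (m' + m) = 0.
Proof.
apply: vspace_of_pred.
  split=> [b _|f e m _ _ _]; first by rewrite ffunE.
  rewrite big1 // => m' _; rewrite /ext; case: insubP => [b _ _|_]; last by rewrite mulr0.
  by rewrite ffunE mulr0.
move=> a t t' [t1 t2] [t'1 t'2]; split=> [b bd|f e m Ff fe em].
  by rewrite !ffunE t1 // t'1 // scaler0 addr0.
transitivity (a * (\sum_(m' <- msupp f) f@_m' * ext t (m' + m)) +
  \sum_(m' <- msupp f) f@_m' * ext t' (m' + m)); last first.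
  by rewrite (t2 _ _ _ Ff fe em) (t'2 _ _ _ Ff fe em) mulr0 addr0.
rewrite mulr_sumr -big_split; apply: eq_bigr => m' _ /=.
by rewrite ext_linear mulrDr; congr (_ + _); rewrite mulrCA.
Qed.

Lemma ver_equations x f e m : f \is e.-homog -> (e + mdeg m = d)%N ->
  \sum_(m' <- msupp f) f@_m' * ext (ver x) (m' + m) = mon x m * f.@[x 0].
Proof.
move=> /dhomogP fe em; rewrite mevalE mulr_sumr; apply: eq_big_seq => m' m'f.
rewrite ext_ver ?monD ?mdegD ?[mdeg m']fe //.
by rewrite mulrCA [_ * mon x m']mulrC [in RHS]mulrCA [mon x m * _]mulrC.
Qed.

(** By [contraction_exchange], a tensor of degree [d] all of whose contractions are multiples of [y]
    is a multiple of the Veronese image of [y], and membership in [K] then says that [y] satisfies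
    the equations of [V]. *)
Lemma veronese_points : exists K : {vspace tensors},
  forall (t : tensors) y, t != 0 -> y != 0 ->
  (t \in K /\ forall w, contraction w t \in <[y]>%VS) <->
  V <[y]>%VS /\ <[t]>%VS = <[ver y]>%VS.
Proof.
have [K KP] := veronese_space; exists K => t y t0 y0; split.
  case=> /KP [t1 t2] tw; have [i yi] := row_neq0 y0.
  have tE := contraction_exchange yi tw.
  pose c := ext t (U_(i) *+ d)%MM / y 0 i ^+ d.
  have yd : y 0 i ^+ d != 0 by rewrite expf_neq0.
  have tc : t = c *: ver y.
    apply/ffunP => b; rewrite !ffunE; case: eqP => [bd|/eqP bd]; last by rewrite scaler0 t1.
    apply: (mulIf yd); rewrite -[t b]ext_val tE //.
    by rewrite /c /GRing.scale /= mulrAC divfK.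
  have c0 : c != 0 by apply: contraNneq t0 => c0; rewrite tc c0 scale0r.
  clearbody c; split; last first.
    apply/eqP; rewrite eqEsubv -!memvE tc memvZ ?memv_line //=.
    by apply/vlineP; exists c^-1; rewrite scalerA mulVf // scale1r.
  apply/VP => // f e Ff fe ed.
  (* The complementary monomial is a power of the variable [i]; it does not vanish at [y], so it can
     be cancelled. *)
  have em : (e + mdeg (U_(i) *+ (d - e) : 'X_{1..n})%MM = d)%N.
    by rewrite mdegMn mdeg1 mul1n subnKC.
  have := t2 f e _ Ff fe em.
  have -> : \sum_(m' <- msupp f) f@_m' * ext t (m' + (U_(i) *+ (d - e))%MM) =
      c * \sum_(m' <- msupp f) f@_m' * ext (ver y) (m' + (U_(i) *+ (d - e))%MM).
    rewrite mulr_sumr; apply: eq_bigr => m' _; rewrite tc -[c *: _]addr0 ext_linear.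
    rewrite mulrCA; congr (_ * _); rewrite /ext; case: insubP => [b _ _|_].
      by rewrite [in X in _ + X]ffunE addr0.
    by rewrite addr0.
  rewrite (ver_equations _ fe em) monUn => /eqP.
  by rewrite !mulf_eq0 (negPf c0) expf_eq0 (negPf yi) andbF /= => /eqP.
case=> Vy tv; have : t \in <[ver y]>%VS by rewrite -tv memv_line.
case/vlineP => c ->; split.
  apply: memvZ; apply/KP; split=> [b bd|f e m Ff fe em].
    by rewrite ffunE (negPf bd).
  rewrite (ver_equations _ fe em) (proj1 (VP y0) Vy f e Ff fe) ?mulr0 //.
  by rewrite -em leq_addr.
by move=> w; rewrite lfZ memvZ // contraction_ver.
Qed.

End Veronese.

(** * Pluecker coordinates *)

Section PluckerCoordinates.
Variables (k : fieldType) (E : vectType k) (d : nat).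
Notation N := (\dim {:E}).

Definition coordmx (X : seq E) : 'M[k]_(d, N) :=
  \matrix_(i, j) coord (vbasis {:E}) j X`_i.

(** Over a general commutative ring, because it is applied to matrices of polynomials as well. *)
Definition minors (R : comNzRingType) (B : 'M[R]_(d, N)) : 'rV[R]_#|plucker_index E d| :=
  \row_t \det (colsub (enum_val t : {ffun _ -> _}) B).

Lemma minors_mul (A : 'M[k]_d) B : minors (A *m B) = \det A *: minors B.
Proof.
apply/rowP => t; rewrite !mxE -det_mulmx; congr (\det _).
by apply/matrixP => i j; rewrite !mxE; apply: eq_bigr => l _; rewrite !mxE.
Qed.

Lemma plucker_basis (U : {vspace E}) (X : d.-tuple E) : basis_of U X ->
  plucker d U = <[minors (coordmx X)]>%VS.
Proof.
move=> XU; have dU : \dim U = d by have /andP [/eqP <- /eqnP ->] := XU; rewrite size_tuple.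
have vU : basis_of U (vbasis U) := vbasisP U.
have sY : size (vbasis U) == d by rewrite size_tuple dU.
have [Y YE] : exists Y : d.-tuple E, Y = vbasis U :> seq E by exists (Tuple sY).
have YU : basis_of U Y by rewrite YE.
pose cm (X Y : d.-tuple E) : 'M[k]_d := \matrix_(i, j) coord X j Y`_i.
have cmE (X' Y' : d.-tuple E) : basis_of U X' -> basis_of U Y' ->
    coordmx Y' = cm X' Y' *m coordmx X'.
  move=> X'U Y'U; apply/matrixP => i j; rewrite !mxE.
  have Yi : Y'`_i \in U by apply: (basis_mem Y'U); rewrite mem_nth ?size_tuple.
  rewrite {1}(coord_basis X'U Yi) linear_sum /=.
  by apply: eq_bigr => l _; rewrite linearZ /= !mxE.
have cm1 : cm X Y *m cm Y X = 1%:M.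
  apply/matrixP => i j; rewrite !mxE.
  have Yi : Y`_i \in U by apply: (basis_mem YU); rewrite mem_nth ?size_tuple.
  rewrite -(coord_free i j (basis_free YU)) [in RHS](coord_basis XU Yi) linear_sum /=.
  by apply: eq_bigr => l _; rewrite linearZ /= !mxE.
have dcm : \det (cm X Y) != 0.
  apply/eqP => dc; have := congr1 determinant cm1.
  by rewrite det_mulmx dc mul0r det1 => /eqP; rewrite eq_sym oner_eq0.
transitivity <[minors (coordmx Y)]>%VS.
  rewrite /plucker; congr (<[_]>%VS); apply/rowP => t; rewrite !mxE; congr (\det _).
  by apply/matrixP => i j; rewrite !mxE YE.
rewrite (cmE _ _ XU YU) minors_mul; apply/eqP; rewrite eqEsubv -!memvE.
rewrite memvZ ?memv_line //=; apply/vlineP; exists (\det (cm X Y))^-1.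
by rewrite scalerA mulVf ?scale1r.
Qed.

(** A repeated column gives 0; otherwise sorting the columns gives a single maximal minor up to the
    sign of the sorting permutation. *)
Lemma det_colsub (f : {ffun 'I_d -> 'I_N}) :
  exists c : 'I_#|plucker_index E d| -> k, forall B : 'M[k]_(d, N),
    \det (colsub f B) = \sum_t c t * minors B 0 t.
Proof.
case: (classic (injective f)) => [finj|fninj]; last first.
  have [i [j [fij ij]]] : exists i j, f i = f j /\ i != j.
    apply: NNPP => H; apply: fninj => i j fij; apply/eqP/negPn/negP => ij.
    by apply: H; exists i, j.
  exists (fun _ => 0) => B; rewrite big1 => [|t _]; last by rewrite mul0r.
  rewrite -det_tr; apply: determinant_alternate ij _ => l.
  by rewrite !mxE fij.
(* The position of the column [f i] in increasing order; the inverse of this permutation sorts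
   [f]. *)
pose rank i := #|[set j | (f j < f i)%N]|.
have rank_lt i j : (f i < f j)%N -> (rank i < rank j)%N.
  move=> fij; apply/proper_card/properP; split.
    by apply/subsetP => l; rewrite !inE => /ltn_trans ->.
  by exists i; rewrite inE // ltnn.
have rankd i : (rank i < d)%N.
  rewrite -[X in (_ < X)%N]card_ord -cardsT; apply/proper_card/properP; split.
    exact: subsetT.
  by exists i; rewrite inE // ltnn.
have rinj : injective (fun i => Ordinal (rankd i)).
  move=> i j /(congr1 val) /= rij; apply: finj; apply: val_inj.
  by case: (ltngtP (f i) (f j)) => [/rank_lt|/rank_lt|//]; rewrite rij ltnn.
pose s := (perm rinj)^-1%g.
have rs i : rank (s i) = i.
  by have := permKV (perm rinj) i; rewrite permE => /(congr1 val).
pose g : {ffun 'I_d -> 'I_N} := [ffun i => f (s i)].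
have gJ : g \in plucker_index E d.
  rewrite inE; apply/forallP => i; apply/forallP => j; apply/implyP => ij.
  rewrite !ffunE; case: (ltngtP (f (s i)) (f (s j))) => // [/rank_lt|fij].
    by rewrite !rs => ji; have := ltn_trans ij ji; rewrite ltnn.
  by have := rs i; rewrite (finj _ _ (val_inj fij)) rs => e; rewrite e ltnn in ij.
exists (fun t => if t == enum_rank_in gJ g then (-1) ^+ s else 0) => B.
rewrite (bigD1 (enum_rank_in gJ g)) //= eqxx big1 ?addr0 => [|t /negPf ->]; last by rewrite mul0r.
rewrite mxE enum_rankK_in //.
have -> : colsub g B = col_perm s (colsub f B).
  by apply/matrixP => i j; rewrite !mxE ffunE.
by rewrite col_permE det_mulmx det_perm mulrCA -signr_addb !odd_permV addbb mulr1.
Qed.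

(** A weak Cauchy-Binet formula. What matters is that the coefficients do not depend on [B], so that
    such determinants are linear forms in the Pluecker coordinates. *)
Lemma det_mul_minors (L : 'M[k]_(N, d)) :
  exists c : 'I_#|plucker_index E d| -> k, forall B : 'M[k]_(d, N),
    \det (B *m L) = \sum_t c t * minors B 0 t.
Proof.
have expand (B : 'M[k]_(d, N)) : \det (B *m L) =
    \sum_(f : {ffun 'I_d -> 'I_N}) (\prod_i L (f i) i) * \det (colsub f B).
  rewrite -det_tr {1}/determinant.
  under eq_bigr => s _.
    under eq_bigr => i _ do rewrite !mxE.
    rewrite bigA_distr_bigA mulr_sumr; over.
  rewrite exchange_big /=; apply: eq_bigr => f _.
  rewrite -[\det (colsub f B)]det_tr {1}/determinant mulr_sumr; apply: eq_bigr => s _.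
  rewrite mulrCA; congr (_ * _); rewrite big_split mulrC; congr (_ * _).
  by apply: eq_bigr => i _; rewrite !mxE.
suff [c cP] : exists c : 'I_#|plucker_index E d| -> k, forall B : 'M[k]_(d, N),
    \sum_(f <- index_enum {ffun 'I_d -> 'I_N}) (\prod_i L (f i) i) * \det (colsub f B) =
    \sum_t c t * minors B 0 t.
  by exists c => B; rewrite expand.
elim: (index_enum _) => [|f s [c cP]].
  by exists (fun _ => 0) => B; rewrite big_nil big1 // => t _; rewrite mul0r.
have [c' c'P] := det_colsub f.
exists (fun t => (\prod_i L (f i) i) * c' t + c t) => B.
rewrite big_cons cP c'P mulr_sumr -big_split; apply: eq_bigr => t _.
by rewrite mulrDl mulrA.
Qed.

Lemma minors_map (R S : comNzRingType) (h : {rmorphism R -> S}) (B : 'M[R]_(d, N)) :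
  map_mx h (minors B) = minors (map_mx h B).
Proof.
apply/rowP => t; rewrite !mxE -det_map_mx; congr (\det _).
by apply/matrixP => i j; rewrite !mxE.
Qed.

End PluckerCoordinates.

Lemma dhomog_bigprod (k : fieldType) n (I : Type) (s : seq I) (P : I -> {mpoly k[n]})
    (e : I -> nat) :
  (forall i, P i \is (e i).-homog) ->
  \prod_(i <- s) P i \is (\sum_(i <- s) e i)%N.-homog.
Proof.
move=> Pe; elim: s => [|i s IH]; first by rewrite !big_nil dhomog1.
by rewrite !big_cons dhomogM.
Qed.

Lemma dhomog_det (k : fieldType) n d (B : 'M[{mpoly k[n]}]_d) (e : 'I_d -> nat) :
  (forall i j, B i j \is (e i).-homog) -> \det B \is (\sum_i e i)%N.-homog.
Proof.
move=> Be; rewrite /determinant rpred_sum // => s _.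
by rewrite -signr_odd; case: odd; rewrite ?mulN1r ?mul1r ?rpredN dhomog_bigprod.
Qed.

(** * The variety of preimages of the points of the Veronese graph *)

Section VeroneseGraph.
Variables (k : fieldType) (n d : nat) (E : vectType k).
Notation T0 := (tensors k n d).
Notation T1 := 'rV[k]_n.
Variables (q : 'Hom(E, (T0 * T1)%type : vectType k)) (V : proj_set k n).
Notation r := (\dim (lker q)).
Notation D := (1 + (1 + r))%N.
Hypotheses (qver : forall x : T1, x != 0 -> V <[x]>%VS -> (ver d x, 0) \in limg q)
  (qrow : forall x, (0, x) \in limg q).

Definition graph (x : T1) : {vspace E} :=
  (q @^-1: (<[(ver d x, 0%R)]> + <[(0%R, x)]>))%VS.

(** A linear choice of preimages, correct where (t, 0) lies in the image of [q]. Linearity makes the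
    coordinates of [graph_basis] polynomial in the point. *)
Definition sec0 (t : T0) : E := (q^-1)%VF (t, 0 : T1).
Definition sec1 (y : T1) : E := (q^-1)%VF (0 : T0, y).

Definition graph_basis (x : T1) : D.-tuple E :=
  [tuple of sec0 (ver d x) :: [tuple of sec1 x :: vbasis (lker q)]].

Lemma sec1K y : q (sec1 y) = (0, y).
Proof. exact: limg_lfunVK (qrow y). Qed.

Lemma sec0K x : x != 0 -> V <[x]>%VS -> q (sec0 (ver d x)) = (ver d x, 0).
Proof. by move=> x0 Vx; apply: limg_lfunVK; apply: qver. Qed.

Lemma graph_basisP x : x != 0 -> V <[x]>%VS -> basis_of (graph x) (graph_basis x).
Proof.
move=> x0 Vx; have v0 := ver_neq0 d x0.
have k0 : <<vbasis (lker q)>>%VS = lker q := span_basis (vbasisP _).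
rewrite /basis_of /graph_basis /= !free_cons !span_cons k0 (basis_free (vbasisP _)) andbT.
apply/and3P; split; last first.
- by rewrite memv_ker sec1K; apply/eqP => -[/eqP]; rewrite (negPf x0).
- apply/negP => /memv_addP [_ /vlineP [a ->] [u uk E0]].
  move: uk; rewrite memv_ker => /eqP uk; move/(congr1 q): E0.
  rewrite sec0K // lfD lfZ uk sec1K addr0 => -[/eqP].
  by rewrite scaler0 (negPf v0).
rewrite eqEsubv; apply/andP; split; apply/subvP => u.
  case/memv_addP => _ /vlineP [a ->] [_ /memv_addP [_ /vlineP [b ->] [w wk ->]] ->].
  move: wk; rewrite memv_ker => /eqP wk; rewrite -memv_preim !lfD !lfZ wk sec0K // sec1K addr0.
  by rewrite memv_add ?memvZ ?memv_line.
rewrite -memv_preim => /memv_addP [_ /vlineP [a ->] [_ /vlineP [b ->] qu]].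
rewrite -[u](subrK (a *: sec0 (ver d x) + b *: sec1 x)) addrC -addrA.
apply: memv_add; first by rewrite memvZ ?memv_line.
apply: memv_add; first by rewrite memvZ ?memv_line.
by rewrite memv_ker lfB lfD !lfZ qu sec0K // sec1K subrr.
Qed.

Definition gminors (x : T1) := minors (coordmx D (graph_basis x)).

Lemma plucker_graph x : x != 0 -> V <[x]>%VS ->
  plucker D (graph x) = <[gminors x]>%VS.
Proof. by move=> x0 Vx; apply: plucker_basis (graph_basisP x0 Vx). Qed.

(** Linear forms matched with [graph_basis]. The last ones are dual to the basis of [lker q], but
    their values at [sec0] and [sec1] are not controlled, so the resulting matrix is triangular
    rather than diagonal. *)
Definition functional (b : 'X_{1..n < d.+1}) (l : 'I_n) (a : 'I_D) (u : E) : k :=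
  match split a with
  | inl _ => (q u).1 b
  | inr a' => match split a' with
    | inl _ => (q u).2 0 l
    | inr i => coord (vbasis (lker q)) i u
    end
  end.

Lemma functional_linear b l a : linear (functional b l a : E -> k^o).
Proof.
move=> c u v; rewrite /functional; case: split => [_|a'].
  by rewrite lfD lfZ !ffunE.
case: split => [_|i]; first by rewrite lfD lfZ !mxE.
by rewrite linearP.
Qed.

(* The determinant is that of a unipotent-by-diagonal triangular matrix. *)
Lemma gminors_forms (b : 'X_{1..n < d.+1}) (l : 'I_n) :
  exists c : 'I_#|plucker_index E D| -> k, forall x, x != 0 -> V <[x]>%VS ->
    \sum_t c t * gminors x 0 t = ver d x b * x 0 l.
Proof.
pose L : 'M[k]_(\dim {:E}, D) := \matrix_(j, a) functional b l a (vbasis {:E})`_j.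
have [c cP] := det_mul_minors L; exists c => x x0 Vx; rewrite -cP.
have LE i a : (coordmx D (graph_basis x) *m L) i a = functional b l a (graph_basis x)`_i.
  rewrite [in RHS](coord_vbasis (memvf (graph_basis x)`_i)) !mxE.
  rewrite (linear_combination _ _ _ _ (@functional_linear b l a)).
  by apply: eq_bigr => j _; rewrite !mxE.
have fl u : functional b l (lshift _ 0) u = (q u).1 b.
  by rewrite /functional (unsplitK (inl _)).
have frl u : functional b l (rshift 1 (lshift _ 0)) u = (q u).2 0 l.
  by rewrite /functional (unsplitK (inr _)) (unsplitK (inl _)).
have frr i u : functional b l (rshift 1 (rshift 1 i)) u = coord (vbasis (lker q)) i u.
  by rewrite /functional !(unsplitK (inr _)).
have kerq (i : 'I_r) : q (vbasis (lker q))`_i = 0.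
  by apply/eqP; rewrite -memv_ker vbasis_mem // mem_nth ?size_tuple.
(* Each functional vanishes on the later members of the basis: [sec1] has no tensor part, and [q]
   kills the basis of [lker q]. *)
rewrite -det_tr det_trig; last first.
  apply/is_trig_mxP => i j ij; rewrite mxE LE.
  case: (splitP i) ij => [i' ei|i' ei]; case: (splitP j) => [j' ej|j' ej] ij.
  - by move: ij; rewrite ei ej !ord1.
  - rewrite (_ : i = lshift _ 0) ?fl; last by apply: val_inj; rewrite /= ei ord1.
    rewrite ej /=; case: (splitP j') => [j'' ->|j'' ->].
      by rewrite ord1 /= sec1K ffunE.
    by rewrite /= kerq ffunE.
  - by move: ij; rewrite ei ej ord1.
  - rewrite ej /=; case: (splitP i') ei => [i'' ei' ei|i'' ei' ei]; last first.
      case: (splitP j') ej => [j'' ej' ej|j'' ej' ej].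
        by move: ij; rewrite ei ej ei' ej' ord1.
      rewrite (_ : i = rshift 1 (rshift 1 i'')) ?frr; last by apply: val_inj; rewrite /= ei ei'.
      rewrite ej' /= coord_free ?(basis_free (vbasisP _)) //.
      case: eqP => // e; move: ij; rewrite ei ej ei' ej' e ltnn //.
    rewrite (_ : i = rshift 1 (lshift _ 0)) ?frl; last by apply: val_inj; rewrite /= ei ei' ord1.
    case: (splitP j') ej => [j'' ej' ej|j'' ej' ej].
      by move: ij; rewrite ei ej ei' ej' !ord1.
    by rewrite ej' /= kerq mxE.
under eq_bigr => i _ do rewrite mxE LE.
rewrite big_split_ord /= big_ord1 fl /= sec0K //=; congr (_ * _).
rewrite big_split_ord /= big_ord1 frl /= sec1K /= big1 ?mulr1 // => i _.
by rewrite frr /= coord_free ?(basis_free (vbasisP _)) ?eqxx.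
Qed.

Lemma gminors_neq0 x : x != 0 -> V <[x]>%VS -> gminors x != 0.
Proof.
move=> x0 Vx; have [i xi] := row_neq0 x0.
have [c cP] := gminors_forms (pure_mon d i) i; have := cP x x0 Vx.
apply: contra_eq_neq => ->; rewrite big1 => [|t _]; last by rewrite mxE mulr0.
by rewrite eq_sym ver_pure mulf_neq0 ?expf_neq0.
Qed.

(** The generic form of [coordmx D (graph_basis x)]. Its rows are homogeneous of degrees d, 1 and 0,
    so all maximal minors have the same degree. *)
Definition graph_poly : 'M[{mpoly k[n]}]_(D, \dim {:E}) :=
  \matrix_(i, j) match split i with
  | inl _ => \sum_(b : 'X_{1..n < d.+1} | mdeg b == d)
      coord (vbasis {:E}) j (sec0 [ffun b' => (b' == b)%:R]) *: 'X_[b]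
  | inr i' => match split i' with
    | inl _ => \sum_(l < n) coord (vbasis {:E}) j (sec1 (delta_mx 0 l)) *: 'X_l
    | inr a => (coord (vbasis {:E}) j (vbasis (lker q))`_a)%:MP
    end
  end.

Definition graph_deg (i : 'I_D) : nat :=
  match split i with
  | inl _ => d
  | inr i' => if split i' is inl _ then 1%N else 0%N
  end.

Lemma graph_poly_homog i j : graph_poly i j \is (graph_deg i).-homog.
Proof.
rewrite mxE /graph_deg; case: split => [_|i'].
  by apply: rpred_sum => b /eqP bd; apply: dhomogZ; rewrite dhomogX; apply/eqP.
case: split => [_|a].
  by apply: rpred_sum => l _; apply: dhomogZ; rewrite dhomogX; apply/eqP; apply: mdeg1.
by rewrite -alg_mpolyC; apply: dhomogZ; apply: dhomog1.
Qed.

Lemma graph_poly_eval (x : T1) :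
  map_mx (meval (x 0)) graph_poly = coordmx D (graph_basis x).
Proof.
apply/matrixP => i j; rewrite !mxE.
case: splitP => [i' ei|i' ei]; rewrite ei.
  rewrite ord1 /= raddf_sum /=.
  have -> : ver d x = \sum_(b : 'X_{1..n < d.+1} | mdeg b == d) mon x b *:
      ([ffun b' => (b' == b)%:R] : T0).
    apply/ffunP => b; rewrite sum_ffunE ffunE; case: eqP => [bd|/eqP bd].
      rewrite (bigD1 b) ?bd //= !ffunE eqxx big1 ?addr0 => [|c /andP [_ cb]].
        by rewrite /GRing.scale /= mulr1.
      by rewrite !ffunE eq_sym (negPf cb) scaler0.
    rewrite big1 // => c cd; rewrite !ffunE; case: eqP => [bc|_]; last by rewrite scaler0.
    by move: bd; rewrite bc cd.
  have sec0L : linear sec0.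
    move=> a t t'; rewrite /sec0 -lfZ -lfD; congr (_ _).
    by apply: (congr2 pair); rewrite /= ?scaler0 ?addr0.
  rewrite (linear_combination _ _ _ _ sec0L) linear_sum; apply: eq_bigr => b _.
  by rewrite mevalZ mevalX linearZ /= mulrC.
case: splitP => [i'' ei'|i'' ei']; rewrite ei'.
  rewrite ord1 /= raddf_sum /= [in RHS](row_sum_delta x).
  have sec1L : linear sec1.
    move=> a t t'; rewrite /sec1 -lfZ -lfD; congr (_ _).
    by apply: (congr2 pair); rewrite /= ?scaler0 ?addr0.
  rewrite (linear_combination _ _ _ _ sec1L) linear_sum; apply: eq_bigr => b _.
  by rewrite mevalZ mevalXU linearZ /= mulrC.
by rewrite /= mevalC.
Qed.

Lemma graphZ a x : a != 0 -> graph (a *: x) = graph x.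
Proof.
move=> a0; rewrite /graph; congr lfun_preim; rewrite verZ.
have lineZ (G : vectType k) (v : G) c : c != 0 -> <[c *: v]>%VS = <[v]>%VS.
  move=> c0; apply/eqP; rewrite eqEsubv -!memvE memvZ ?memv_line //=.
  by apply/vlineP; exists c^-1; rewrite scalerA mulVf ?scale1r.
rewrite -(@lineZ _ (ver d x, 0) (a ^+ d)) ?expf_neq0 // -(@lineZ _ (0, x) a) //.
by congr (<[_]> + <[_]>)%VS; apply: (congr2 pair); rewrite /= ?scaler0.
Qed.

Definition graph_set : proj_set k #|plucker_index E D| :=
  fun L => exists x, [/\ x != 0, V <[x]>%VS & L = plucker D (graph x)].

(** With [i] such that [y 0 i] is nonzero, the forms of [gminors_forms] have the values y_i^d y_l at
    [y]; proportional minors therefore give proportional vectors. *)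
Lemma graph_inj x y : x != 0 -> V <[x]>%VS -> y != 0 -> V <[y]>%VS ->
  plucker D (graph x) = plucker D (graph y) -> <[x]>%VS = <[y]>%VS.
Proof.
move=> x0 Vx y0 Vy; rewrite !plucker_graph // => e.
have /vlineP [a ea] : gminors y \in <[gminors x]>%VS by rewrite e memv_line.
have [i yi] := row_neq0 y0.
have yE l : y 0 i ^+ d * y 0 l = a * (x 0 i ^+ d) * x 0 l.
  have [c cP] := gminors_forms (pure_mon d i) l.
  rewrite -!ver_pure -cP // -mulrA -cP // ea mulr_sumr; apply: eq_bigr => t _.
  by rewrite mxE mulrCA.
have yx : y = (a * x 0 i ^+ d / y 0 i ^+ d) *: x.
  apply/rowP => l; rewrite mxE; apply: (mulfI (expf_neq0 d yi)); rewrite yE.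
  by rewrite mulrA [_ * (_ / _)]mulrC divfK ?expf_neq0.
apply/esym/eqP; rewrite eqEdim !dim_vline x0 y0 leqnn andbT -memvE yx.
by rewrite memvZ ?memv_line.
Qed.

Lemma graph_variety_iso : (forall L, V L -> \dim L = 1%N) -> variety_iso graph_set V.
Proof.
move=> Vdim.
pose psi L := plucker D (graph (vpick L)).
have pick (x : T1) : x != 0 -> exists2 a, a != 0 & vpick <[x]>%VS = a *: x.
  move=> x0; have /vlineP [a ea] := memv_pick <[x]>%VS; exists a => //.
  apply: contraNneq x0 => a0; have := vpick0 <[x]>%VS.
  by rewrite ea a0 scale0r eqxx -dimv_eq0 dim_vline; case: (x == 0).
have psiE (x : T1) : x != 0 -> psi <[x]>%VS = plucker D (graph x).
  by move=> x0; rewrite /psi; have [a a0 ->] := pick x x0; rewrite graphZ.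
have Vline L : V L -> exists2 x, x != 0 & L = <[x]>%VS.
  move=> /Vdim dL; exists (vpick L); first by rewrite vpick0 -dimv_eq0 dL.
  by apply/esym/eqP; rewrite eqEdim -memvE memv_pick dim_vline vpick0 -dimv_eq0 dL.
(* The inverse is chosen pointwise; [graph_inj] determines it on [graph_set], and linear forms in
   the Pluecker coordinates then show that it is regular. *)
pose phi (L' : {vspace 'rV[k]_#|plucker_index E D|}) : {vspace 'rV[k]_n} :=
  epsilon (inhabits 0%VS) (fun L => V L /\ psi L = L').
have phiP L' : graph_set L' -> V (phi L') /\ psi (phi L') = L'.
  move=> [x [x0 Vx ->]].
  apply: (@epsilon_spec _ (inhabits 0%VS) (fun L => V L /\ psi L = _)).
  by exists <[x]>%VS; rewrite psiE.
have phiE (x : T1) : x != 0 -> V <[x]>%VS -> phi (plucker D (graph x)) = <[x]>%VS.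
  move=> x0 Vx; have [|Vp] := phiP (plucker D (graph x)); first by exists x.
  have [y y0 yE] := Vline _ Vp; rewrite yE in Vp *; rewrite psiE //.
  exact: graph_inj.
exists phi, psi; split; last 1 first.
- move=> L VL; have [x x0 xE] := Vline _ VL; rewrite xE in VL *.
  by rewrite psiE // phiE.
- split=> [L /phiP [] //|z z0 [x [x0 Vx zE]]].
  have [i xi] := row_neq0 x0.
  have [c cP] : exists c : 'I_n -> 'I_#|plucker_index E D| -> k, forall l (x : T1),
      x != 0 -> V <[x]>%VS ->
      \sum_t c l t * gminors x 0 t = ver d x (pure_mon d i) * x 0 l.
    exact: fin_all_exists (fun l => gminors_forms (pure_mon d i) l).
  (* At the graph of [w] these linear forms are proportional to w_i^d w_l, so together they return
     [w] wherever w_i is nonzero; [f i] itself defines this neighbourhood. *)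
  pose f l : {mpoly k[_]} := \sum_t c l t *: 'X_t.
  have fh l : f l \is 1.-homog.
    by apply: rpred_sum => t _; apply: dhomogZ; rewrite dhomogX; apply/eqP; apply: mdeg1.
  have fE y (w : T1) l : w != 0 -> V <[w]>%VS -> <[y]>%VS = plucker D (graph w) ->
      exists2 a, y = a *: gminors w & (f l).@[y 0] = a * (ver d w (pure_mon d i)) * w 0 l.
    move=> w0 Vw yE; have : y \in <[y]>%VS by apply: memv_line.
    rewrite yE plucker_graph // => /vlineP [a ya]; exists a => //.
    rewrite -mulrA -cP // raddf_sum mulr_sumr; apply: eq_bigr => t _ /=.
    by rewrite mevalZ mevalXU ya mxE mulrCA.
  exists 1%N, 1%N, (f i), f; split=> //.
    have [a za ->] := fE z x i x0 Vx zE; rewrite ver_pure !mulf_neq0 ?expf_neq0 //.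
    by apply: contraNneq z0 => a0; rewrite za a0 scale0r.
  move=> y y0 [w [w0 Vw yE]] gy /=.
  have [a ya _] := fE y w i w0 Vw yE.
  pose b := a * ver d w (pure_mon d i).
  have fyE : \row_l (f l).@[y 0] = b *: w.
    apply/rowP => l; rewrite !mxE; have [a' ya' ->] := fE y w l w0 Vw yE.
    have : (a' - a) *: gminors w == 0 by rewrite scalerBl -ya' -ya subrr.
    rewrite scaler_eq0 (negPf (gminors_neq0 w0 Vw)) orbF subr_eq0 => /eqP ->.
    by [].
  have b0 : b != 0.
    apply: contraNneq gy => b0; move/rowP/(_ i): fyE; rewrite !mxE b0 mul0r => ->.
    by [].
  rewrite fyE scaler_eq0 negb_or b0 w0; split=> //.
  rewrite yE phiE //; apply/eqP; rewrite eq_sym eqEdim !dim_vline w0.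
  by rewrite scaler_eq0 negb_or b0 w0 leqnn andbT -memvE memvZ ?memv_line.
- split=> [L VL|x x0 Vx].
    have [x x0 xE] := Vline _ VL; rewrite xE in VL *.
    by exists x; rewrite psiE.
  (* One chart suffices, hence the denominator 1: the minors have no common zero on [V]. *)
  exists 0%N, (\sum_i graph_deg i)%N, 1, (fun t => minors graph_poly 0 t); split.
  + exact: dhomog1.
  + move=> t; rewrite mxE; apply: dhomog_det => i j; rewrite mxE.
    exact: graph_poly_homog.
  + by rewrite meval1 oner_neq0.
  move=> y y0 Vy _ /=.
  have -> : \row_t (minors graph_poly 0 t).@[y 0] = gminors y.
    rewrite /gminors -graph_poly_eval -minors_map.
    by apply/rowP => t; rewrite !mxE.
  by rewrite gminors_neq0 // psiE // plucker_graph.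
- by move=> L /phiP [].
Qed.

End VeroneseGraph.

Lemma variety_iso_ext (k : fieldType) n m (V V' : proj_set k n) (W : proj_set k m) :
  (forall L, V L <-> V' L) -> variety_iso V W -> variety_iso V' W.
Proof.
move=> VV' [phi [psi [[phiV phiR] [psiW psiR] psiK phiK]]].
exists phi, psi; split=> // [||L /VV' VL]; last exact: psiK.
- split=> [L /VV' VL|x x0 /VV' Vx]; first exact: phiV.
  have [d [e [g [f [gd fe gx fP]]]]] := phiR x x0 Vx.
  by exists d, e, g, f; split=> // y y0 /VV'; apply: fP.
- split=> [L WL|x x0 Wx]; first by apply/VV'/psiW.
  exact: psiR.
Qed.

Theorem proposition1 (k : closedFieldType) (Lambda : fdalg k)
    (Lambda_wild : controlled_wild Lambda)
    (n : nat) (V : proj_set k n.+1) (V_closed : zariski_closed V) :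
  exists (D Y : fdmod Lambda) (e : dimvec (endop D)) (d : nat),
    total_dim e d /\ variety_iso (quiver_grassmannian (hom_mod D Y) e d) V.
Proof.
have [F [d [d0 VP]]] := zariski_closed_bounded_degree V_closed.
have [K KP] := veronese_points d0 VP.
have [D [Y [q [e [eT qK eU]]]]] := tri_realization (@contraction k n.+1 d) K Lambda_wild.
exists D, Y, e, (1 + (1 + \dim (lker q)))%N; split=> //.
have qver (x : 'rV[k]_n.+1) : x != 0 -> V <[x]>%VS -> (ver d x, 0) \in limg q.
  move=> x0 Vx; apply/qK => /=.
  by have [_ /(_ (conj Vx erefl)) []] := KP _ x (ver_neq0 d x0) x0.
have qrow (x : 'rV[k]_n.+1) : (0, x) \in limg q by apply/qK; rewrite mem0v.
have Vdim L : V L -> \dim L = 1%N by case: V_closed => F' [_ VE] /VE [].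
(* It remains to see that the quiver Grassmannian and [graph_set] have the same points. *)
apply: variety_iso_ext (graph_variety_iso qver qrow Vdim) => L; split.
  case=> x [x0 Vx ->].
  have [|sU eq_e] := proj2 (eU (graph q x)) _.
    exists (ver d x), x; have v0 := ver_neq0 d x0.
    by have [_ /(_ (conj Vx erefl)) [vK vw]] := KP _ x v0 x0; split.
  exists (graph q x), sU; split=> //.
  by have := graph_basisP qver qrow x0 Vx => /andP [/eqP <- /eqnP ->]; rewrite size_tuple.
case=> U [sU [eU' dU ->]].
have [t [y [t0 y0 tK tw UE]]] := proj1 (eU U) (ex_intro _ sU eU').
have [/(_ (conj tK tw)) [Vy ty] _] := KP t y t0 y0.
(* [U] is given by [t] and the graph by the Veronese image of [y]; both span the same line by
   [ty]. *)
exists y; split=> //; congr plucker; rewrite UE /graph.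
have vlineE (a b : tensors k n.+1 d) : a \in <[b]>%VS ->
    (<[(a, 0%R : 'rV[k]_n.+1)]> <= <[(b, 0%R : 'rV[k]_n.+1)]>)%VS.
  case/vlineP => c ->; rewrite -memvE; apply/vlineP; exists c.
  by apply: (congr2 pair); rewrite /= ?scaler0.
congr (q @^-1: (_ + _))%VS; apply/eqP; rewrite eqEsubv !vlineE //.
  by rewrite ty memv_line.
by rewrite -ty memv_line.
Qed.
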